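(* Let $m\ge1$ and let $f:\mathbb{R}^2\to\mathbb{R}^m_1$ be a smooth vector-valued function such that $M=\operatorname{graph} f=\{(x,f(x)):x\in\mathbb{R}^2\}\subset\mathbb{R}^{2+m}_1$ is a spacelike stationary surface. Then there exist real numbers $a$ and $b$ with $b>0$, hence a nonsingular linear transformation $$x_1=u_1,\qquad x_2=a u_1+b u_2,$$ such that $(u_1,u_2)$ are global isothermal parameters for $M$.
   Context: $\mathbb{R}^m_1$ denotes $\mathbb{R}^m$ with the Minkowski inner product $\langle \mathbf{u},\mathbf{v}\rangle=u_1v_1+\cdots+u_{m-1}v_{m-1}-u_mv_m$. Identify $\mathbb{R}^{2+m}_1=\mathbb{R}^2\oplus\mathbb{R}^m_1$, where $\mathbb{R}^2$ carries the Euclidean inner product. For smooth $f:\mathbb{R}^2\to\mathbb{R}^m_1$, put $p=\partial f/\partial x_1$, $q=\partial f/\partial x_2$. The induced metric on $M=\operatorname{graph} f\subset\mathbb{R}^{2+m}_1$ in the global coordinates $(x_1,x_2)$ is $g=g_{ij}dx_idx_j$ with $g_{11}=1+\langle p,p\rangle$, $g_{22}=1+\langle q,q\rangle$, $g_{12}=g_{21}=\langle p,q\rangle$. $M$ is spacelike if $(g_{ij})$ is positive definite at every point; then $W:=\det(g_{ij})^{1/2}>0$. A spacelike surface is stationary if its mean curvature vector field vanishes identically; equivalently, all coordinate functions of $\mathbb{R}^{2+m}_1$ restricted to $M$ are harmonic for the Laplace–Beltrami operator $\Delta F=W^{-1}\partial_i(Wg^{ij}\partial_jF)$ of $g$, where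 $(g^{ij})=(g_{ij})^{-1}$. $(u_1,u_2)$ being global isothermal parameters means that $g=\lambda\,(du_1^2+du_2^2)$ on all of $M$ for some positive smooth function $\lambda$. *)

(* Defs.v *)
From HB Require Import structures.
From mathcomp Require Import all_boot all_order all_algebra.
From mathcomp Require Import all_classical all_reals all_analysis.

Set Implicit Arguments.
Unset Strict Implicit.
Unset Printing Implicit Defensive.

Import Order.TTheory GRing.Theory Num.Theory.
Import numFieldNormedType.Exports.

Local Open Scope ring_scope.
Local Open Scope classical_set_scope.

Section Smooth.
Variables (R : realType) (n : nat) (V : normedModType R).

Definition partial (i : 'I_n) (F : 'rV[R]_n -> V) : 'rV[R]_n -> V :=
  'D_(delta_mx 0 i) F.

Fixpoint class_C (k : nat) (F : 'rV[R]_n -> V) : Prop :=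
  match k with
  | 0 => continuous F
  | k'.+1 => (forall x, differentiable F x) /\
             (forall i, class_C k' (partial i F))
  end.

Definition smooth (F : 'rV[R]_n -> V) : Prop := forall k, class_C k F.

End Smooth.

Section Surfaces.
Variable R : realType.

(* u_1 v_1 + ... + u_(n-1) v_(n-1) - u_n v_n : with indices starting at 0, the
   negative sign is on the index i with i + 1 = n. *)
Definition minkowski n (u v : 'rV[R]_n) : R :=
  \sum_(i < n) (-1) ^+ (i.+1 == n) * (u 0 i * v 0 i).

Lemma minkowski_row_mx m (m_gt0 : (0 < m)%N) (x y : 'rV[R]_2) (p q : 'rV[R]_m) :
  minkowski (row_mx x p) (row_mx y q) =
  \sum_(i < 2) x 0 i * y 0 i + minkowski p q.
Proof.
rewrite /minkowski big_split_ord /=; congr (_ + _); apply: eq_bigr => i _.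
  rewrite !row_mxEl ltn_eqF ?mul1r //.
  by rewrite -[(_.+2 <= _)%N]/(i.+1 < 2 + m)%N -addn1 leq_add.
by rewrite !row_mxEr /= -[(2 + i).+1]addnS eqn_add2l.
Qed.

(* A parametrized surface in R^n_1 is a map X : R^2 -> R^n. *)
Section Immersion.
Variables (n : nat) (X : 'rV[R]_2 -> 'rV[R]_n).

Definition metric (x : 'rV[R]_2) : 'M[R]_2 :=
  \matrix_(i, j) minkowski (partial i X x) (partial j X x).

Definition spacelike : Prop :=
  forall (x v : 'rV[R]_2), v != 0 -> 0 < (v *m metric x *m v^T) 0 0.

(* v minus its tangential part g^{kl} <v, d_k X> d_l X. *)
Definition normal_part (x : 'rV[R]_2) (v : 'rV[R]_n) : 'rV[R]_n :=
  v - \sum_k \sum_l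
        (invmx (metric x) k l * minkowski v (partial k X x)) *: partial l X x.

(* Half the trace g^{ij} h_ij of the second fundamental form
   h_ij = (d_i d_j X)^normal. *)
Definition mean_curvature (x : 'rV[R]_2) : 'rV[R]_n :=
  2^-1 *: \sum_i \sum_j
            invmx (metric x) i j *: normal_part x (partial i (partial j X) x).

Definition stationary : Prop := forall x, mean_curvature x = 0.

End Immersion.

(* phi expresses the given parameters x in terms of the new ones u; it is a
   diffeomorphism of the whole plane. *)
Definition global_isothermal n (X : 'rV[R]_2 -> 'rV[R]_n)
    (phi : 'rV[R]_2 -> 'rV[R]_2) : Prop :=
  [/\ smooth phi,
      exists psi : 'rV[R]_2 -> 'rV[R]_2,
        [/\ smooth psi, cancel phi psi & cancel psi phi]
    & exists lambda : 'rV[R]_2 -> R,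
        [/\ smooth lambda, forall u, 0 < lambda u &
            forall u, metric (X \o phi) u = (lambda u)%:M]].

Definition graph_map m (f : 'rV[R]_2 -> 'rV[R]_m) (x : 'rV[R]_2) :
  'rV[R]_(2 + m) := row_mx x (f x).

Lemma partial_graph_map m (f : 'rV[R]_2 -> 'rV[R]_m) x i :
  differentiable f x ->
  partial i (graph_map f) x = row_mx (delta_mx 0 i) (partial i f x).
Proof.
move=> df; have der : derivable f x (delta_mx 0 i) by exact: diff_derivable.
have dg : derivable (graph_map f) x (delta_mx 0 i).
  apply/derivable_mxP => a b; rewrite ord1 -(fintype.splitK b); case: (fintype.split b) => c.
    rewrite (_ : (fun _ => _) = (fun y : 'rV[R]_2 => y 0 c)); last first.
      by apply/funext => y; rewrite row_mxEl.
    exact/diff_derivable/differentiable_coord.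
  rewrite (_ : (fun _ => _) = (fun y => f y 0 c)); last first.
    by apply/funext => y; rewrite row_mxEr.
  by have /derivable_mxP := der; exact.
rewrite /partial derive_mx //; apply/rowP => b; rewrite mxE.
rewrite -(fintype.splitK b); case: (fintype.split b) => c.
  rewrite row_mxEl (_ : (fun _ => _) = (fun y : 'rV[R]_2 => y 0 c)); last first.
    by apply/funext => y; rewrite row_mxEl.
  have := derive_mx (@derivable_id R 'rV[R]_2 x (delta_mx 0 i)).
  by rewrite derive_id => /rowP/(_ c) ->; rewrite mxE.
rewrite row_mxEr (_ : (fun _ => _) = (fun y => f y 0 c)); last first.
  by apply/funext => y; rewrite row_mxEr.
by rewrite derive_mx // mxE.
Qed.

Lemma metric_graph_map m (m_gt0 : (0 < m)%N) (f : 'rV[R]_2 -> 'rV[R]_m) x i j :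
  differentiable f x ->
  metric (graph_map f) x i j =
  (i == j)%:R + minkowski (partial i f x) (partial j f x).
Proof.
move=> df; rewrite mxE !partial_graph_map // minkowski_row_mx //; congr (_ + _).
rewrite (bigD1 i) //= big1 => [|k /negPf ki]; last first.
  by rewrite !mxE ki mul0r.
by rewrite !mxE !eqxx mul1r addr0.
Qed.

Definition shear (a b : R) (u : 'rV[R]_2) : 'rV[R]_2 :=
  \row_(i < 2) if i == 0 then u 0 0 else a * u 0 0 + b * u 0 1.

End Surfaces.

(* Main.v *)
(** The metric [g] divided by its area element is a unimodular symmetric matrix
    [(r, s; s, t)]. Stationarity gives [G f_11 - 2 F f_12 + E f_22 = 0], and hence
    that [r dx + s dy = dF] and [s dx + t dy = dG] are exact. For the conformal
    structure of [g] the functions [z = (x + F) + i (y + G)] and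
    [e = (x - F) + i (G - y)] are holomorphic; since [(F, G)] is a monotone map,
    [|x| <= |z|] and [|e| <= |z|]. Choose the constant [k] such that [e - k z]
    vanishes to second order at [0]. Then [(e - k z)^2 / z^3] is holomorphic off
    [0] and tends to [0] at [0] and at infinity, so that it vanishes by the maximum
    principle. Thus [e = k z], which forces [r, s, t] to be constant, and then a
    shear makes [g] conformal to the identity. *)
Require Import Defs.
From mathcomp Require Import all_boot all_order all_algebra.
From mathcomp Require Import all_classical all_reals all_analysis.
From mathcomp Require Import ring lra.
Import Order.TTheory GRing.Theory Num.Theory.
Import numFieldNormedType.Exports.
Local Open Scope ring_scope.
Local Open Scope classical_set_scope.

Set Implicit Arguments.
Unset Strict Implicit.
Unset Printing Implicit Defensive.

(* [all_analysis] shadows this name by the Minkowski inequality. *)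
Local Notation minkowski := Defs.minkowski.

(** Since [(F, G)] has a symmetric Jacobian matrix of determinant 1, the core is Jörgens' theorem: a
    convex function on the whole plane with Hessian determinant 1 is quadratic; [z] is Lewy's
    transform. The signature matters little. No gradient bound is available, as [<p,p>] may be
    negative, but pairing the vector equation with [p] and [q] leaves only the coefficients of [g]
    and their derivatives, and positivity of [g] suffices from there on. The function [z] is never
    shown to be a coordinate: every estimate is made in the original variables through [|x| <= |z|].
    The exponents 2 and 3 come from this. With [h = e - k z], the quotient [h^a / z^b] is of order
    [|x|^(2a-b)] at 0 and [|x|^(a-b)] at infinity, so [a < b < 2a] is required, and 2, 3 are the
    least such integers. Vanishing at both ends replaces the removable singularity theorem and
    Liouville's theorem. The constant [k] is the ratio of the derivatives of [e] and [z] at 0. It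
    satisfies [|k| < 1], which makes the final linear equations for [r, s, t] uniquely solvable. *)

(** * Calculus rules for gradients of functions on the plane *)

Section Gradient.
Variable R : realType.
Notation plane := 'rV[R]_2.
Implicit Types (f g : plane -> R) (x v : plane).

(** The values [a] and [b] are arguments, so that the rules below compute them and [grad_eq] leaves
    only identities for [ring] or [field]. *)
Definition grad_at f x (a b : R) :=
  [/\ differentiable f x, partial 0 f x = a & partial 1 f x = b].

Lemma ord2P (i : 'I_2) : i = 0 \/ i = 1.
Proof. by case: i => -[|[|//]] ?; [left|right]; exact/val_inj. Qed.

Lemma plane_basis v : v = v 0 0 *: delta_mx 0 0 + v 0 1 *: delta_mx 0 1.
Proof.
apply/rowP => i; rewrite !mxE eqxx /=.
have [->|->] := ord2P i.
  by rewrite eqxx mulr1 mulr0 addr0.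
by rewrite eqxx mulr1 mulr0 add0r.
Qed.

Lemma diff_grad f x v a b : grad_at f x a b -> 'd f x v = v 0 0 * a + v 0 1 * b.
Proof.
move=> [df fa fb]; rewrite {1}(plane_basis v) linearD !linearZ /=.
by rewrite -!deriveE // -[X in X = _]/(v 0 0 * partial 0 f x + v 0 1 * partial 1 f x) fa fb.
Qed.

Lemma is_derive_line_dir f x v (t a : R) : is_derive (x + t *: v) v f a ->
  is_derive t 1 (fun s : R => f (x + s *: v)) a.
Proof.
move=> [dv <-].
have E : (fun h : R => h^-1 *: (((fun s : R => f (x + s *: v)) \o shift t) (h *: 1)
     - f (x + t *: v))) =
  (fun h : R => h^-1 *: ((f \o shift (x + t *: v)) (h *: v) - f (x + t *: v))).
  apply/funext => h /=; congr (_ *: (f _ - _)).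
  by rewrite scalerDl addrCA [h *: 1]mulr1.
by split; rewrite /derivable /derive E.
Qed.

Lemma is_derive_line f x v (t a b : R) : grad_at f (x + t *: v) a b ->
  is_derive t 1 (fun s : R => f (x + s *: v)) (v 0 0 * a + v 0 1 * b).
Proof.
move=> fab; have [df _ _] := fab; apply: is_derive_line_dir.
by split; [exact: diff_derivable | rewrite deriveE // (diff_grad v fab)].
Qed.

Lemma grad_cst (c : R) x : grad_at (fun=> c) x 0 0.
Proof.
split; first exact: differentiable_cst.
  exact: derive_cst.
exact: derive_cst.
Qed.

Lemma grad_coord (i : 'I_2) x :
  grad_at (fun y => y 0 i) x (0 == i)%:R (1 == i)%:R.
Proof.
have h j : partial j (fun y : plane => y 0 i) x = (j == i)%:R.
  have /rowP/(_ i) := derive_mx (@derivable_id R plane x (delta_mx 0 j)).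
  by rewrite derive_id mxE mxE /partial => <-; rewrite eqxx /= eq_sym.
by split=> //; exact: differentiable_coord.
Qed.

Lemma gradD f g x a b c d : grad_at f x a b -> grad_at g x c d ->
  grad_at (fun y => f y + g y) x (a + c) (b + d).
Proof.
move=> [df <- <-] [dg <- <-]; split; first exact: differentiableD.
  by apply: deriveD; exact: diff_derivable.
by apply: deriveD; exact: diff_derivable.
Qed.

Lemma gradN f x a b : grad_at f x a b -> grad_at (fun y => - f y) x (- a) (- b).
Proof.
move=> [df <- <-]; split; first exact: differentiableN.
  by apply: deriveN; exact: diff_derivable.
by apply: deriveN; exact: diff_derivable.
Qed.

Lemma gradB f g x a b c d : grad_at f x a b -> grad_at g x c d ->
  grad_at (fun y => f y - g y) x (a - c) (b - d).
Proof. by move=> fab /gradN; exact: gradD. Qed.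

Lemma gradM f g x a b c d : grad_at f x a b -> grad_at g x c d ->
  grad_at (fun y => f y * g y) x (f x * c + g x * a) (f x * d + g x * b).
Proof.
move=> [df <- <-] [dg <- <-]; split; first exact: differentiableM.
  by apply: deriveM; exact: diff_derivable.
by apply: deriveM; exact: diff_derivable.
Qed.

Lemma gradMl (k : R) f x a b : grad_at f x a b ->
  grad_at (fun y => k * f y) x (k * a) (k * b).
Proof.
by move=> /(gradM (grad_cst k x)) /=; rewrite !mulr0 !addr0.
Qed.

Lemma gradV f x a b : f x != 0 -> grad_at f x a b ->
  grad_at (fun y => (f y)^-1) x (- a / f x ^+ 2) (- b / f x ^+ 2).
Proof.
move=> fx [df <- <-]; split; first exact: differentiableV.
  rewrite /partial (deriveV fx) /GRing.scale /=; last exact: diff_derivable.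
  by rewrite !mulNr mulrC.
rewrite /partial (deriveV fx) /GRing.scale /=; last exact: diff_derivable.
by rewrite !mulNr mulrC.
Qed.

Lemma grad_eq f x a b a' b' :
  grad_at f x a b -> a = a' -> b = b' -> grad_at f x a' b'.
Proof. by move=> + <- <-. Qed.

Lemma grad_uniq f x a b a' b' :
  grad_at f x a b -> grad_at f x a' b' -> a = a' /\ b = b'.
Proof. by move=> [_ <- <-] [_ <- <-]. Qed.

End Gradient.

(** * Primitives of continuous functions on the line *)

Section Primitive.
Variable R : realType.

Lemma is_derive_subr (f g : R -> R) (t a b : R) :
  is_derive t 1 f a -> is_derive t 1 g b ->
  is_derive t 1 (fun s => f s - g s) (a - b).
Proof. by move=> df dg; exact: (@is_deriveB _ _ _ f g t 1 a b). Qed.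

Lemma derive0_cst (f : R -> R) (a b : R) : a < b ->
  (forall t, a <= t <= b -> is_derive t 1 f 0) -> f a = f b.
Proof.
move=> ab df.
have [t||c _] := @MVT R f (fun=> 0) a b ab.
- by rewrite in_itv /= => /andP[h1 h2]; apply: df; rewrite !ltW.
- apply: derivable_within_continuous => t; rewrite in_itv /= => h.
  by have [] := df t h.
by rewrite mul0r => /eqP; rewrite subr_eq0 => /eqP ->.
Qed.

(** The integral from the fixed left end [a], normalized to vanish at 0 so that the primitives for
    different [a] coincide. *)
Lemma primitive_right (f : R -> R) (a : R) : continuous f -> a < 0 ->
  exists2 F : R -> R, F 0 = 0 & forall t : R, a < t -> is_derive t 1 F (f t).
Proof.
move=> cf a0.
pose I x := (\int[@lebesgue_measure R]_(t in `[a, x]) (f t))%R.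
exists (fun x => I x - I 0); first by rewrite subrr.
move=> t at_.
have intf : (@lebesgue_measure R).-integrable `[a, t + 1] (EFin \o f).
  apply: continuous_compact_integrable; first exact: segment_compact.
  exact/continuous_subspaceT.
have [|dI fI] := @continuous_FTC1_closed R f a t (t + 1) _ intf at_ (cf t).
  by rewrite ltrDl.
have : is_derive t 1 I (f t).
  by apply: DeriveDef; [exact: dI | rewrite -derive1E; exact: fI].
by move=> /is_derive_subr/(_ (is_derive_cst (I 0) t 1)); rewrite subr0.
Qed.

(** The primitives on the half-lines to the right of [-(|x| + 1)] agree where two of them are
    defined, since both vanish at 0. The diagonal [P t t] therefore coincides near each point with a
    single one of them. *)
Lemma continuous_primitive (f : R -> R) : continuous f ->
  exists2 F : R -> R, F 0 = 0 & forall t : R, is_derive t 1 F (f t).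
Proof.
move=> cf.
have /choice[P HP] : forall x : R, exists F : R -> R,
    F 0 = 0 /\ forall t : R, - (`|x| + 1) < t -> is_derive t 1 F (f t).
  move=> x; have [|F F0 dF] := @primitive_right f (- (`|x| + 1)) cf.
    by rewrite oppr_lt0 ltr_wpDl.
  by exists F.
have agree x y t : - (`|x| + 1) < t -> - (`|y| + 1) < t -> P x t = P y t.
  move=> xt yt; have [Px0 dPx] := HP x; have [Py0 dPy] := HP y.
  have x0 : - (`|x| + 1) < 0 by rewrite oppr_lt0 ltr_wpDl.
  have y0 : - (`|y| + 1) < 0 by rewrite oppr_lt0 ltr_wpDl.
  have d s : - (`|x| + 1) < s -> - (`|y| + 1) < s ->
      is_derive s 1 (fun u => P x u - P y u) 0.
    move=> xs ys; rewrite -[0](subrr (f s)).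
    exact: is_derive_subr (dPx s xs) (dPy s ys).
  have D0 : P x 0 - P y 0 = 0 by rewrite Px0 Py0 subr0.
  suff : P x t - P y t = 0 by move/eqP; rewrite subr_eq0 => /eqP.
  have [t0|t0|->] := ltgtP t 0; last by [].
    rewrite -D0; apply: (@derive0_cst (fun u => P x u - P y u) t 0 t0) => s.
    move=> /andP[ts _].
    by apply: d; apply: lt_le_trans ts.
  rewrite -D0; apply/esym.
  apply: (@derive0_cst (fun u => P x u - P y u) 0 t t0) => s /andP[s0 _].
  by apply: d; apply: lt_le_trans s0.
exists (fun t => P t t); first by have [] := HP 0.
move=> t; have [_ /(_ t)] := HP t.
have tt : - (`|t| + 1) < t by have := ler_norm (- t); rewrite normrN; lra.
move=> /(_ tt); apply: near_eq_is_derive.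
have : \forall s \near t, - (`|t| + 1) < s by apply: lt_nbhsr.
apply: filterS => s ts; apply: agree => //.
by have := ler_norm (- s); rewrite normrN; lra.
Qed.

End Primitive.

(** The differential is defined by choice among the continuous linear maps with a little-o
    expansion; the bound shows that [L] is such a map, and uniqueness identifies the choice with
    it. *)
Lemma differentiable_of_bound (R : realType) (V W : normedModType R)
    (f : V -> W) (L : {linear V -> W}) (x : V) : continuous L ->
  (forall e : R, 0 < e ->
    \forall h \near (0 : V), `|f (x + h) - f x - L h| <= e * `|h|) ->
  differentiable f x /\ 'd f x = L :> (V -> W).
Proof.
move=> Lc H.
have dxf : f \o shift x = cst (f x) + L +o_ 0 id.
  apply/eqaddoP => e e0; have := H e e0; apply: filterS => h.
  by rewrite /= !fctE /= opprD addrA [h + x]addrC.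
split; last exact: diff_unique.
apply/diffP => /=.
apply: (@getPex _ (fun (df : {linear V -> W}) => continuous df /\
  forall y, f y = f (lim (nbhs x)) + df (y - lim (nbhs x))
                  +o_(y \near x) (y - lim (nbhs x)))).
exists L; split=> //; apply: eqaddoEx => z.
have /funeqP/(_ (z - x)) := dxf.
rewrite /= !fctE subrK => ->; rewrite lim_id //; congr (_ + _).
rewrite -(comp_centerK x id) -[X in the_littleo _ _ _ X](comp_centerK x).
by rewrite -[_ (z - x)]/((_ \o (center x)) z) -littleo_center0.
Qed.

(** * Epsilon-delta forms of differentiability and continuity in the plane *)

Section PlaneCalculus.
Variable R : realType.
Notation plane := 'rV[R]_2.
Implicit Types (f g : plane -> R) (x v h : plane).

Lemma norm_coord_le x i : `|x 0 i| <= `|x|.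
Proof.
rewrite [`|x|]mx_normrE.
by apply: (@le_bigmax_cond _ _ _ _ (0, i) xpredT (fun ij => `|x ij.1 ij.2|)).
Qed.

Lemma norm_plane_le x (e : R) : `|x 0 0| <= e -> `|x 0 1| <= e -> `|x| <= e.
Proof.
move=> x0 x1; rewrite [`|x|]mx_normrE.
apply/bigmax_leP; split; first exact: le_trans x0.
move=> [i j] _ /=; rewrite (ord1 i).
by have [->|->] := ord2P j.
Qed.

Lemma grad_bound f x a b : grad_at f x a b -> forall e : R, 0 < e ->
  exists2 d : R, 0 < d & forall h, `|h| < d ->
    `|f (x + h) - f x - (h 0 0 * a + h 0 1 * b)| <= e * `|h|.
Proof.
move=> fab e e0; have [df _ _] := fab.
have /eqaddoP/(_ e e0)/nbhs_ballP[d /= d0 H] := diff_locally df.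
exists d => // h hd; have := H h; rewrite -ball_normE /= sub0r normrN => /(_ hd).
by rewrite /= !fctE /= (diff_grad _ fab) opprD addrA [h + x]addrC.
Qed.

Lemma grad_of_bound f x a b :
  (forall e : R, 0 < e -> exists2 d : R, 0 < d & forall h, `|h| < d ->
    `|f (x + h) - f x - (h 0 0 * a + h 0 1 * b)| <= e * `|h|) ->
  grad_at f x a b.
Proof.
move=> H; pose l (y : plane) := a * y 0 0 + b * y 0 1.
have gl : grad_at l 0 a b.
  have := gradD (gradMl a (grad_coord 0 0)) (gradMl b (grad_coord 1 0)).
  by move=> /grad_eq; apply; rewrite /= !(mulr0, mulr1, addr0, add0r).
have [dl _ _] := gl; pose L := 'd l (0 : plane).
(* Taking [L] as the differential of the linear function [l] supplies it already packaged as a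
   continuous linear map. *)
have LE h : L h = h 0 0 * a + h 0 1 * b by exact: diff_grad.
have Lc : continuous L by exact: diff_continuous.
have [//|df E] := @differentiable_of_bound R plane R f L x Lc.
  move=> e /H[d d0 Hd]; apply/nbhs_ballP; exists d => //= h.
  by rewrite -ball_normE /= sub0r normrN LE => /Hd.
have LD i : partial i f x = L (delta_mx 0 i).
  by rewrite /partial (deriveE _ df); exact: (congr1 (fun k => k _) E).
split; first exact: df.
  by rewrite LD LE !mxE eqxx mul1r mul0r addr0.
by rewrite LD LE !mxE eqxx mul1r mul0r add0r.
Qed.

Lemma continuous_bound f x : {for x, continuous f} -> forall e : R, 0 < e ->
  exists2 d : R, 0 < d & forall y, `|y - x| < d -> `|f y - f x| <= e.
Proof.
move=> + e e0 => /cvgrPdist_le/(_ _ e0)/nbhs_ballP[d /= d0 H].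
exists d => // y yx; rewrite distrC; apply: H.
by rewrite -ball_normE /= distrC.
Qed.

End PlaneCalculus.

(** * Mean value theorem and functions with continuous partials *)

Section MeanValue.
Variable R : realType.
Notation plane := 'rV[R]_2.
Notation e_ i := (delta_mx 0 i : plane).
Implicit Types (f F P Q : plane -> R) (x y v w : plane).

(** The end [b] may lie on either side of [a], so that increments of both signs are treated at
    once. *)
Lemma MVT_abs (p q : R -> R) (a b : R) :
  (forall t : R, `|t - a| <= `|b - a| -> is_derive t 1 p (q t)) ->
  exists2 c, `|c - a| <= `|b - a| & p b - p a = (b - a) * q c.
Proof.
move=> dp.
have cp (u v : R) : (forall t, u <= t <= v -> `|t - a| <= `|b - a|) ->
    {within `[u, v], continuous p}.
  move=> uv; apply: derivable_within_continuous => t; rewrite in_itv /= => h.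
  by have [] := dp t (uv t h).
have [ab|ba|->] := ltgtP a b; last by exists b; rewrite ?subrr ?normr0 ?mul0r.
  have H t : a <= t <= b -> `|t - a| <= `|b - a|.
    by move=> /andP[ac cb]; rewrite !ger0_norm ?subr_ge0 ?(ltW ab) // lerD2r.
  have [||c + E] := @MVT_segment R p q a b (ltW ab); last 1 first.
  - by rewrite in_itv /= => /H; exists c => //; rewrite E mulrC.
  - by move=> t; rewrite in_itv /= => /andP[h1 h2]; apply/dp/H; rewrite !ltW.
  - exact: cp.
have H t : b <= t <= a -> `|t - a| <= `|b - a|.
  by move=> /andP[bc ca]; rewrite !ler0_norm ?subr_le0 ?(ltW ba) // lerN2 lerD2r.
have [||c + E] := @MVT_segment R p q b a (ltW ba); last 1 first.
- rewrite in_itv /= => /H; exists c => //.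
  by rewrite -opprB E -mulrN opprB mulrC.
- by move=> t; rewrite in_itv /= => /andP[h1 h2]; apply/dp/H; rewrite !ltW.
- exact: cp.
Qed.

Lemma is_derive_dir_line F x v (a : R) :
  is_derive (0 : R) 1 (fun s : R => F (x + s *: v)) a -> is_derive x v F a.
Proof.
have E : (fun h : R => h^-1 *: (((fun s : R => F (x + s *: v)) \o shift 0) (h *: 1)
     - F (x + 0 *: v))) = (fun h : R => h^-1 *: ((F \o shift x) (h *: v) - F x)).
  apply/funext => h /=; rewrite scale0r !addr0 [h *: 1]mulr1.
  by rewrite [x + _]addrC.
by move=> [dv <-]; split; [move: dv|]; rewrite /derivable /derive E.
Qed.

Lemma is_derive_of_bound (p : R -> R) (t a : R) :
  (forall e : R, 0 < e ->
     exists2 d : R, 0 < d & forall h, `|h| < d ->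
       `|p (t + h) - p t - h * a| <= e * `|h|) ->
  is_derive t 1 p a.
Proof.
move=> H.
suff C : h^-1 *: ((p \o shift t) (h *: 1) - p t) @[h --> 0^'] --> a.
  by split; [apply/cvg_ex; exists a | exact: cvg_lim C].
apply/cvgrPdist_le => e e0; have [d d0 He] := H e e0.
near=> h.
have h0 : h != 0 by near: h; exact: nbhs_dnbhs_neq.
have : `|p (t + h) - p t - h * a| <= e * `|h|.
  by apply: He; near: h; exact: dnbhs0_lt.
rewrite /= [h *: 1]mulr1 [h + t]addrC => Hh.
have -> : a - h^-1 *: (p (t + h) - p t) = - (h^-1 * (p (t + h) - p t - h * a)).
  by rewrite /GRing.scale /=; field.
rewrite normrN normrM normfV ler_pdivrMl ?normr_gt0 // [`|h| * e]mulrC.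
Unshelve. all: by end_near. Qed.

(** Go from [x] to [x + h] horizontally and then vertically: the mean value theorem on each leg
    leaves a value of [P] or [Q] at a point within [|h|] of [x]. *)
Lemma grad_of_continuous_partials F P Q x :
  (forall y, is_derive y (e_ 0) F (P y)) -> (forall y, is_derive y (e_ 1) F (Q y)) ->
  {for x, continuous P} -> {for x, continuous Q} -> grad_at F x (P x) (Q x).
Proof.
move=> dP dQ cP cQ; apply: grad_of_bound => e e0.
have e20 : 0 < e / 2 by rewrite divr_gt0.
have [d1 d10 H1] := continuous_bound cP e20.
have [d2 d20 H2] := continuous_bound cQ e20.
exists (Num.min d1 d2); first by rewrite lt_min d10.
move=> h; rewrite lt_min => /andP[hd1 hd2].
have [c] := MVT_abs (a := 0) (b := h 0 1) (fun t _ => @is_derive_line_dir R F (x + h 0 0 *: e_ 0) (e_ 1) t _ (dQ _)).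
rewrite !subr0 scale0r addr0 => ch cE.
have [b] := MVT_abs (a := 0) (b := h 0 0) (fun t _ => @is_derive_line_dir R F x (e_ 0) t _ (dP _)).
rewrite !subr0 scale0r addr0 => bh bE.
rewrite {1}(plane_basis h) addrA.
set y := x + h 0 0 *: e_ 0 + c *: e_ 1 in cE.
set z := x + b *: e_ 0 in bE.
have -> : F (x + h 0 0 *: e_ 0 + h 0 1 *: e_ 1) - F x - (h 0 0 * P x + h 0 1 * Q x) =
  h 0 0 * (P z - P x) + h 0 1 * (Q y - Q x).
  rewrite !mulrBr -cE -bE; ring.
rewrite (le_trans (ler_normD _ _)) // !normrM.
have h0 := norm_coord_le h 0; have h1 := norm_coord_le h 1.
have Pz : `|P z - P x| <= e / 2.
  apply: H1; apply: le_lt_trans hd1.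
  rewrite /z addrC addKr.
  by apply: norm_plane_le; rewrite !mxE ?eqxx /= ?mulr1 ?mulr0 ?normr0 //; exact: le_trans h0.
have Qy : `|Q y - Q x| <= e / 2.
  apply: H2; apply: le_lt_trans hd2.
  rewrite /y -(addrA x) [_ - x]addrC addKr.
  apply: norm_plane_le; rewrite !mxE ?eqxx /= ?mulr1 ?mulr0 ?normr0 ?addr0 ?add0r //.
  exact: le_trans h1.
rewrite [e]splitr mulrDl lerD // mulrC ler_pM //.
Qed.

End MeanValue.

(** * Second differences and the symmetry of mixed partials *)

Section YoungPoincare.
Variable R : realType.
Notation plane := 'rV[R]_2.
Notation e_ i := (delta_mx 0 i : plane).
Implicit Types (f a b F P Q : plane -> R) (x y v w : plane).

Lemma grad_continuous f x (c d : R) : grad_at f x c d -> {for x, continuous f}.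
Proof. by move=> [df _ _]; exact: differentiable_continuous. Qed.

(* By the mean value theorem in the direction [v], the second difference of [f]
   along [v] and [w] is [h] times an increment of the derivative along [v]. *)
Lemma second_difference f a b x v w (D a0 a1 b0 b1 d : R) : 0 < d ->
  (forall y, `|y - x| < d -> grad_at f y (a y) (b y)) ->
  grad_at a x a0 a1 -> grad_at b x b0 b1 ->
  D = w 0 0 * (v 0 0 * a0 + v 0 1 * b0) + w 0 1 * (v 0 0 * a1 + v 0 1 * b1) ->
  forall e : R, 0 < e -> exists2 d' : R, 0 < d' & forall h : R, `|h| < d' ->
    `|f (x + h *: v + h *: w) - f (x + h *: v) - f (x + h *: w) + f x - h ^+ 2 * D|
      <= e * h ^+ 2.
Proof.
move=> d0 fab ga gb DE e e0.
pose k y := v 0 0 * a y + v 0 1 * b y.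
have gk : grad_at k x (v 0 0 * a0 + v 0 1 * b0) (v 0 0 * a1 + v 0 1 * b1).
  by apply: gradD; exact: gradMl.
pose M := `|v| + `|w| + 1.
have M0 : 0 < M by rewrite ltr_wpDl // addr_ge0.
(* The increment of [k] is compared with [h D] through two first-order expansions at [x], each at a
   displacement of norm at most [|h| M]; each contributes half of the error. *)
have eM0 : 0 < e / (M * 2) by rewrite divr_gt0 // mulr_gt0.
have [d1 d10 Hk] := grad_bound gk eM0.
exists (Num.min d d1 / M); first by rewrite divr_gt0 // lt_min d0.
move=> h; rewrite ltr_pdivlMr // lt_min => /andP[hd hd1].
have small s t : `|s| <= `|h| -> `|t| <= `|h| ->
    `|s *: v + t *: w| <= `|h| * M.
  move=> sh th; rewrite (le_trans (ler_normD _ _)) // !normrZ /M 2!mulrDr mulr1.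
  by rewrite ler_wpDr // lerD // ler_wpM2r.
have [|c] := @MVT_abs R
    (fun s : R => f (x + h *: w + s *: v) - f (x + s *: v))
    (fun s : R => k (x + h *: w + s *: v) - k (x + s *: v)) 0 h.
  move=> s; rewrite !subr0 => sh; apply: is_derive_subr.
    apply/is_derive_line/fab; rewrite -(addrA x) [_ - x]addrC addKr addrC.
    exact: le_lt_trans (small _ _ sh (lexx _)) hd.
  apply/is_derive_line/fab; rewrite [_ - x]addrC addKr.
  apply: le_lt_trans hd; have := small s 0 sh.
  by rewrite scale0r addr0 normr0; apply.
rewrite !subr0 !scale0r !addr0 => ch E.
have B1 := Hk (h *: w + c *: v); have B2 := Hk (c *: v).
have n1 := small _ _ ch (lexx _); rewrite addrC in n1.
have n2 : `|c *: v| <= `|h| * M.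
  by have := small c 0 ch; rewrite scale0r addr0 normr0; apply.
have {}B1 := le_trans (B1 (le_lt_trans n1 hd1)) (ler_wpM2l (ltW eM0) n1).
have {}B2 := le_trans (B2 (le_lt_trans n2 hd1)) (ler_wpM2l (ltW eM0) n2).
have eE : e / (M * 2) * (`|h| * M) = e / 2 * `|h|.
  by field; rewrite gt_eqF.
rewrite eE in B1 B2.
have -> : f (x + h *: v + h *: w) - f (x + h *: v) - f (x + h *: w) + f x - h ^+ 2 * D =
    h * (k (x + h *: w + c *: v) - k (x + c *: v) - h * D).
  by rewrite mulrBr -E (addrAC x (h *: w)); ring.
rewrite normrM -real_normK ?num_real // expr2 mulrCA ler_wpM2l //.
apply: (le_trans _ (_ : e / 2 * `|h| + e / 2 * `|h| <= _)); last first.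
  by rewrite -mulrDl -splitr.
apply: le_trans (lerD B1 B2).
apply: le_trans (ler_normB _ _).
rewrite le_eqVlt; apply/orP; left; apply/eqP; congr `|_|.
by rewrite DE !mxE (addrA x); ring.
Qed.

(** The second difference is symmetric in its two directions, so that after division by [h^2] the
    same quantity tends to both [a1] and [b0]. Differentiability of the first partials at the single
    point [x] suffices. *)
Lemma young f a b x (a0 a1 b0 b1 d : R) : 0 < d ->
  (forall y, `|y - x| < d -> grad_at f y (a y) (b y)) ->
  grad_at a x a0 a1 -> grad_at b x b0 b1 -> a1 = b0.
Proof.
move=> d0 fab ga gb; apply/eqP; rewrite -subr_eq0 -normr_le0.
apply/ler_addgt0Pr => e e0; rewrite add0r.
have e20 : 0 < e / 2 by rewrite divr_gt0.
have [|d1 d10 H1] := @second_difference f a b x (e_ 0) (e_ 1) a1 _ _ _ _ d d0 fab ga gb _ _ e20.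
  by rewrite !mxE !eqxx /=; ring.
have [|d2 d20 H2] := @second_difference f a b x (e_ 1) (e_ 0) b0 _ _ _ _ d d0 fab ga gb _ _ e20.
  by rewrite !mxE !eqxx /=; ring.
pose h := Num.min d1 d2 / 2.
have h0 : 0 < h by rewrite divr_gt0 // lt_min d10.
have hm : `|h| < Num.min d1 d2.
  by rewrite gtr0_norm // ltr_pdivrMr // ltr_pMr ?ltr1n // lt_min d10.
move: hm; rewrite lt_min => /andP[/H1 {}H1 /H2 {}H2].
have h20 : 0 < h ^+ 2 by rewrite exprn_gt0.
rewrite -(ler_pM2r h20) -{1}(gtr0_norm h20) -normrM [e]splitr (mulrDl (e / 2)).
apply: le_trans (lerD H2 H1); apply: le_trans (ler_normB _ _).
rewrite le_eqVlt; apply/orP; left; apply/eqP; congr `|_|.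
rewrite (addrAC x (h *: e_ 1)); ring.
Qed.

End YoungPoincare.

(** * Closed forms on the plane are exact *)

Section PoincareLemma.
Variable R : realType.
Notation plane := 'rV[R]_2.
Notation e_ i := (delta_mx 0 i : plane).
Implicit Types (F P Q : plane -> R) (x y : plane).

Definition pt (s t : R) : plane := s *: e_ 0 + t *: e_ 1.

Lemma pt0 s t : pt s t 0 0 = s.
Proof. by rewrite !mxE eqxx /= mulr1 mulr0 addr0. Qed.

Lemma pt1 s t : pt s t 0 1 = t.
Proof. by rewrite !mxE eqxx /= mulr1 mulr0 add0r. Qed.

Lemma ptE x : pt (x 0 0) (x 0 1) = x.
Proof. by rewrite [RHS]plane_basis. Qed.

Lemma pt_shift0 s t h : pt (s + h) t = pt s t + h *: e_ 0.
Proof. by rewrite /pt scalerDl addrAC. Qed.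

Lemma is_derive_addl (p : R -> R) (u t a : R) : is_derive (u + t) 1 p a ->
  is_derive t 1 (fun s => p (u + s)) a.
Proof.
have E : (fun h : R => h^-1 *: (((fun s : R => p (u + s)) \o shift t) (h *: 1)
     - p (u + t))) = (fun h : R => h^-1 *: ((p \o shift (u + t)) (h *: 1) - p (u + t))).
  by apply/funext => h /=; rewrite addrCA.
by move=> [dv <-]; split; [move: dv|]; rewrite /derivable /derive E.
Qed.

Lemma is_derive_addr (p q : R -> R) (t a b : R) :
  is_derive t 1 p a -> is_derive t 1 q b ->
  is_derive t 1 (fun s => p s + q s) (a + b).
Proof. by move=> dp dq; exact: (@is_deriveD _ _ _ p q t 1 a b). Qed.

Lemma is_derive_mull (p : R -> R) (k t a : R) : is_derive t 1 p a ->
  is_derive t 1 (fun s => k * p s) (k * a).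
Proof. by move=> dp; exact: (@is_deriveZ _ _ _ p k t 1 a). Qed.

(** Compactness of [[-b, b]] makes the continuity in the first variable uniform in the second. *)
Lemma continuous_tube F (s b : R) : continuous F -> forall e : R, 0 < e ->
  exists2 d : R, 0 < d & forall h c : R, `|h| < d -> `|c| <= b ->
    `|F (pt (s + h) c) - F (pt s c)| <= e.
Proof.
move=> cF e e0; have e20 : 0 < e / 2 by rewrite divr_gt0.
have /compact_near_coveringP cK := @segment_compact R (- b) b.
have := cK R (nbhs (0 : R))
  (fun h c => `|F (pt (s + h) c) - F (pt s c)| <= e) (nbhs_filter _).
case=> [c _|d /= d0 H].
  have [d d0 H] := continuous_bound (cF (pt s c)) e20.
  exists ([set c' : R | `|c' - c| < d], [set h : R | `|h| < d]) => /=.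
    split; apply/nbhs_ballP; exists d => // z.
      by rewrite -ball_normE /= distrC.
    by rewrite -ball_normE /= sub0r normrN.
  move=> [c' h] /= [c'd hd].
  have near_pt z : `|z| < d -> `|pt (s + z) c' - pt s c| < d.
    move=> zd; have lt_max : Num.max `|z| `|c' - c| < d by rewrite gt_max zd.
    apply: le_lt_trans lt_max; apply: norm_plane_le.
      by rewrite mxE pt0 mxE pt0 addrC addKr le_max lexx.
    by rewrite mxE pt1 mxE pt1 le_max lexx orbT.
  have A1 := H _ (near_pt h hd).
  have A2 : `|F (pt s c') - F (pt s c)| <= e / 2.
    by have := H _ (near_pt 0 _); rewrite addr0 normr0; apply.
  have -> : F (pt (s + h) c') - F (pt s c') =
      (F (pt (s + h) c') - F (pt s c)) - (F (pt s c') - F (pt s c)) by ring.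
  by rewrite (le_trans (ler_normB _ _)) // [e]splitr lerD.
exists d => // h c hd cb; apply: (H h).
  by rewrite /ball_ /= sub0r normrN.
by rewrite /= in_itv /= -ler_norml.
Qed.

(** The primitive integrates [P] along the horizontal axis and then [Q] along a vertical line. The
    dependence of the vertical integral on the line is handled by mean values instead of
    differentiation under the integral. *)
Lemma poincare P Q P0 P1 Q1 :
  (forall x, grad_at P x (P0 x) (P1 x)) ->
  (forall x, grad_at Q x (P1 x) (Q1 x)) -> continuous P1 ->
  exists2 F, F 0 = 0 & forall x, grad_at F x (P x) (Q x).
Proof.
move=> gP gQ cP1.
have cQ x : {for x, continuous Q} := grad_continuous (gQ x).
have cP x : {for x, continuous P} := grad_continuous (gP x).
have dline G G0 G1 (s : plane) (t : R) (i : 'I_2) : (forall x, grad_at G x (G0 x) (G1 x)) ->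
    is_derive t 1 (fun t => G (s + t *: e_ i))
      (e_ i 0 0 * G0 (s + t *: e_ i) + e_ i 0 1 * G1 (s + t *: e_ i)).
  by move=> gG; exact: is_derive_line.
have cline G G0 G1 (s : plane) (i : 'I_2) : (forall x, grad_at G x (G0 x) (G1 x)) ->
    continuous (fun t : R => G (s + t *: e_ i)).
  move=> gG t; apply: differentiable_continuous; apply/derivable1_diffP.
  by have [] := dline G G0 G1 s t i gG.
have [A A0 dA] := continuous_primitive (cline P P0 P1 0 0 gP).
have /choice[K HK] : forall s : R, exists K : R -> R, K 0 = 0 /\
    forall t : R, is_derive t 1 K (Q (s *: e_ 0 + t *: e_ 1)).
  move=> s; have [K K0 dK] := continuous_primitive (cline Q P1 Q1 (s *: e_ 0) 1 gQ).
  by exists K.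
exists (fun x => A (x 0 0) + K (x 0 0) (x 0 1)).
  by rewrite !mxE A0 (HK 0).1 addr0.
have dK (s t : R) : is_derive s 1 (fun s => K s t) (P (pt s t) - P (pt s 0)).
  apply: is_derive_of_bound => e e0.
  pose b := `|t| + 1.
  have b0 : 0 < b by rewrite ltr_wpDl.
  have eb0 : 0 < e / b by rewrite divr_gt0.
  have [d d0 H] := continuous_tube s b cP1 eb0.
  exists d => // h hd.
  (* A mean value in the second variable reduces the error to an increment of [Q] minus [h P1].
     Since [P1] is also the first partial of [Q], a mean value in the first variable then leaves [h]
     times an oscillation of [P1], which the tube estimate bounds. *)
  have [c _|c] := @MVT_abs R
      (fun t => K (s + h) t - K s t - h * P (pt s t))
      (fun t => Q (pt (s + h) t) - Q (pt s t) - h * P1 (pt s t)) 0 t.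
    apply: is_derive_subr; first exact: is_derive_subr (proj2 (HK _) _) (proj2 (HK _) _).
    have := dline P P0 P1 (s *: e_ 0) c 1 gP; rewrite !mxE /= mul0r mul1r add0r => dP.
    exact: is_derive_mull dP.
  rewrite !subr0 !(HK _).1 => ct E.
  have cb : `|c| <= b by rewrite (le_trans ct) // ler_wpDr.
  have [z0 _|z] := @MVT_abs R (fun z => Q (pt s c + z *: e_ 0))
      (fun z => P1 (pt s c + z *: e_ 0)) 0 h.
    by have := dline Q P1 Q1 (pt s c) z0 0 gQ; rewrite !mxE /= mul0r mul1r addr0.
  rewrite !subr0 scale0r addr0 -!pt_shift0 => zh E2.
  have -> : K (s + h) t - K s t - h * (P (pt s t) - P (pt s 0)) =
      t * (h * (P1 (pt (s + z) c) - P1 (pt s c))).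
    by rewrite [X in _ = t * X]mulrBr -E2 -E; ring.
  rewrite !normrM mulrCA mulrC ler_wpM2r //.
  have Hz := H _ _ (le_lt_trans zh hd) cb.
  have tb : `|t| <= b by rewrite ler_wpDr.
  rewrite -[e](divfK (lt0r_neq0 b0)) mulrC ler_pM //.
have K_line (u t : R) : is_derive u 1 (fun s => A s + K s t) (P (pt u t)).
  rewrite (_ : P _ = P (0 + u *: e_ 0) + (P (pt u t) - P (pt u 0))).
    exact: is_derive_addr (dA u) (dK u t).
  by rewrite add0r [X in _ - P X]/pt scale0r addr0 addrC subrK.
move=> x; apply: grad_of_continuous_partials => // y; apply: is_derive_dir_line.
  have := is_derive_addl (u := y 0 0) (t := 0); rewrite addr0 => /(_ _ _ (K_line _ (y 0 1))).
  rewrite ptE; congr is_derive; apply/funext => s.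
  by rewrite !mxE eqxx /= mulr1 mulr0 addr0.
have := is_derive_addl (u := y 0 1) (t := 0); rewrite addr0 => /(_ _ _ ((HK (y 0 0)).2 _)).
rewrite -/(pt (y 0 0) (y 0 1)) ptE => /(is_derive_addr (is_derive_cst (A (y 0 0)) (0 : R) 1)).
rewrite add0r; congr is_derive; apply/funext => s.
by rewrite !mxE eqxx /= mulr1 mulr0 addr0.
Qed.

End PoincareLemma.

(** * Maximum principle on the punctured plane *)

Section MaximumPrinciple.
Variable R : realType.
Notation plane := 'rV[R]_2.
Notation e_ i := (delta_mx 0 i : plane).
Implicit Types (f a b u : plane -> R) (x y v : plane).

(* The symmetric second difference [2 f x - f (x + h v) - f (x - h v)] is
   nonnegative at a maximum. *)
Lemma local_max_hessian f a b x v (a0 a1 b0 b1 d : R) : 0 < d ->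
  (forall y, `|y - x| < d -> grad_at f y (a y) (b y)) ->
  grad_at a x a0 a1 -> grad_at b x b0 b1 ->
  (forall y, `|y - x| < d -> f y <= f x) ->
  v 0 0 * (v 0 0 * a0 + v 0 1 * b0) + v 0 1 * (v 0 0 * a1 + v 0 1 * b1) <= 0.
Proof.
move=> d0 fab ga gb fmax; set D := (X in X <= 0).
apply/ler_addgt0Pr => e e0; rewrite add0r.
have [|d1 d10 H] := @second_difference R f a b x v (- v) (- D) _ _ _ _ d d0 fab ga gb _ _ e0.
  by rewrite !mxE /D; ring.
pose h := Num.min d1 (d / (`|v| + 1)) / 2.
have v1 : 0 < `|v| + 1 by rewrite ltr_wpDl.
have m0 : 0 < Num.min d1 (d / (`|v| + 1)) by rewrite lt_min d10 divr_gt0.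
have h0 : 0 < h by rewrite divr_gt0.
have hm : h < Num.min d1 (d / (`|v| + 1)) by rewrite ltr_pdivrMr // ltr_pMr ?ltr1n.
move: hm; rewrite lt_min => /andP[hd1 hd].
have hv : `|h *: v| < d.
  rewrite normrZ gtr0_norm //; move: hd; rewrite ltr_pdivlMr //; apply: le_lt_trans.
  by rewrite ler_wpM2l ?(ltW h0) // lerDl.
have := H h; rewrite gtr0_norm // => /(_ hd1).
rewrite scalerN addrK => /ler_normlW.
have f1 : f (x + h *: v) <= f x by apply: fmax; rewrite [_ - x]addrC addKr.
have f2 : f (x - h *: v) <= f x by apply: fmax; rewrite [_ - x]addrC addKr normrN.
have h20 : 0 < h ^+ 2 by rewrite exprn_gt0.
move=> H'; rewrite -(ler_pM2r h20).
have : - (h ^+ 2 * - D) <= e * h ^+ 2 by apply: le_trans H'; lra.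
by rewrite mulrN opprK mulrC.
Qed.

Lemma continuous_of_bound (V : normedModType R) (g : V -> R) (x : V) :
  (forall e : R, 0 < e ->
     exists2 d : R, 0 < d & forall y : V, `|y - x| < d -> `|g y - g x| <= e) ->
  {for x, continuous g}.
Proof.
move=> H; apply/cvgrPdist_le => e e0; have [d d0 Hd] := H e e0.
apply/nbhs_ballP; exists d => // y; rewrite -ball_normE /= => xy.
by rewrite distrC; apply: Hd; rewrite distrC.
Qed.

(** If [u] were positive somewhere, then for a small [k] the sum of [u] and [k] times the squared
    Euclidean norm would have a local maximum away from 0. There the operator would be nonpositive,
    yet its value is [2 k (r + t) > 0]. *)
Lemma elliptic_max_principle (r s t u a b a0 a1 b0 b1 : plane -> R) :
  (forall x, r x * t x - s x ^+ 2 = 1) -> (forall x, 0 < r x) ->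
  (forall x, x != 0 -> [/\ grad_at u x (a x) (b x),
     grad_at a x (a0 x) (a1 x), grad_at b x (b0 x) (b1 x) &
     t x * a0 x - 2 * s x * a1 x + r x * b1 x = 0]) ->
  u 0 = 0 ->
  (forall e : R, 0 < e ->
     exists2 d : R, 0 < d & forall x, `|x| < d -> `|u x| <= e) ->
  (forall e : R, 0 < e -> exists d : R, forall x, d < `|x| -> `|u x| <= e) ->
  forall x, u x <= 0.
Proof.
move=> det1 r0 Hu u0 lim0 limoo x; rewrite leNgt; apply/negP => ux.
have um2 : 0 < u x / 2 by rewrite divr_gt0.
have [M HM] := limoo _ um2.
pose rho := Num.max M `|x| + 1.
have rho1 : 1 <= rho by rewrite lerDr le_max normr_ge0 orbT.
have rho0 : 0 < rho by exact: lt_le_trans ltr01 rho1.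
have xrho : `|x| <= rho by rewrite ler_wpDr // le_max lexx orbT.
have Mrho : M < rho by rewrite ltr_pwDr // le_max lexx.
(* The norm is the sup norm, so the sum of squares is at most [2 rho^2] on [A] and the perturbation
   at most [u x / 4]. On the boundary [u <= u x / 2], hence [w < u x] there. *)
pose k := u x / (8 * rho ^+ 2).
have rho20 : 0 < 8 * rho ^+ 2 by rewrite mulr_gt0 // exprn_gt0.
have k0 : 0 < k by rewrite divr_gt0.
pose w y := u y + k * (y 0 0 * y 0 0 + y 0 1 * y 0 1).
have gsq y : grad_at (fun y : plane => k * (y 0 0 * y 0 0 + y 0 1 * y 0 1)) y
    (2 * k * y 0 0) (2 * k * y 0 1).
  have g0 := grad_coord 0 y; have g1 := grad_coord 1 y.
  apply: (grad_eq (gradMl k (gradD (gradM g0 g0) (gradM g1 g1)))); rewrite /=; ring.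
have cu y : {for y, continuous u}.
  have [->|y0] := eqVneq y 0; last by have [g _ _ _] := Hu y y0; exact: grad_continuous g.
  apply: continuous_of_bound => e e0; have [d d0 Hd] := lim0 e e0.
  by exists d => // z; rewrite u0 !subr0; exact: Hd.
have cw : continuous w by move=> y; apply: cvgD (cu y) (grad_continuous (gsq y)).
pose A := [set y : plane | `|y| <= rho].
have cA : compact A.
  apply: bounded_closed_compact.
    by exists rho; split => [|z rz y /= yA]; [exact: num_real | exact: le_trans yA (ltW rz)].
  apply: (@closed_comp _ _ (fun y : plane => `|y|) [set z : R | z <= rho]).
    by move=> y _; exact: norm_continuous.
  exact: closed_le.
have [|c cA' cmax] := @EVT_max_rV R 2 w A _ cA (continuous_subspaceT cw).
  by exists x.
have cx : u x <= w c.
  apply: le_trans (cmax x _); last by rewrite inE.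
  by rewrite /w lerDl mulr_ge0 ?(ltW k0) // -!expr2 addr_ge0 ?sqr_ge0.
have sq_le y : `|y| <= rho -> k * (y 0 0 * y 0 0 + y 0 1 * y 0 1) <= u x / 4.
  move=> yr; have sq i : y 0 i * y 0 i <= rho ^+ 2.
    rewrite -expr2 -real_normK ?num_real // ler_pXn2r ?nnegrE ?(ltW rho0) //.
    exact: le_trans (norm_coord_le _ _) yr.
  apply: (@le_trans _ _ (k * (rho ^+ 2 + rho ^+ 2))).
    by rewrite ler_wpM2l ?(ltW k0) // lerD.
  rewrite /k le_eqVlt; apply/orP; left; apply/eqP; field.
  by rewrite gt_eqF.
have c0 : c != 0.
  apply/eqP => c0; move: cx; rewrite c0 /w u0 !mxE mulr0 add0r addr0 mulr0.
  by rewrite leNgt ux.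
have crho : `|c| < rho.
  have : `|c| <= rho by move: cA'; rewrite inE.
  rewrite le_eqVlt => /orP[/eqP cr|//].
  have := HM c; rewrite cr => /(_ Mrho) /ler_normlW uc.
  by have := sq_le c; rewrite cr => /(_ (lexx _)); move: cx; rewrite /w; lra.
(* This radius keeps the ball around [c] inside [A] and off 0, where [u] is only known to be
   continuous. *)
pose d := Num.min (rho - `|c|) `|c|.
have d0 : 0 < d by rewrite lt_min subr_gt0 crho normr_gt0.
have near_c y : `|y - c| < d -> y != 0 /\ `|y| <= rho.
  rewrite lt_min => /andP[h1 h2]; split.
    by apply/eqP => y0; move: h2; rewrite y0 sub0r normrN ltxx.
  by rewrite -(subrK c y) (le_trans (ler_normD _ _)) // -lerBrDr ltW.
have wmax y : `|y - c| < d -> w y <= w c.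
  by move=> /near_c[_ yr]; apply: cmax; rewrite inE.
have gw y : `|y - c| < d -> grad_at w y (a y + 2 * k * y 0 0) (b y + 2 * k * y 0 1).
  by move=> /near_c[y0 _]; have [g _ _ _] := Hu y y0; exact: gradD.
have [gu ga gb E] := Hu c c0.
have ga' : grad_at (fun y => a y + 2 * k * y 0 0) c (a0 c + 2 * k) (a1 c).
  by apply: (grad_eq (gradD ga (gradMl (2 * k) (grad_coord 0 c)))); rewrite /=; ring.
have gb' : grad_at (fun y => b y + 2 * k * y 0 1) c (b0 c) (b1 c + 2 * k).
  by apply: (grad_eq (gradD gb (gradMl (2 * k) (grad_coord 1 c)))); rewrite /=; ring.
have ab := young d0 gw ga' gb'.
(* Because [r t = 1 + s^2], the operator multiplied by [r] is the sum of the pure second derivatives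
   along [(1, 0)] and [(-s, r)]. *)
have H1 := local_max_hessian (pt 1 0) d0 gw ga' gb' wmax.
have H2 := local_max_hessian (pt (- s c) (r c)) d0 gw ga' gb' wmax.
rewrite !pt0 !pt1 -ab in H1 H2.
have t0 : 0 < t c.
  rewrite -(pmulr_rgt0 _ (r0 c)); have := det1 c; have := sqr_ge0 (s c); lra.
have : 0 < r c * (2 * k * (t c + r c)).
  by apply: mulr_gt0 => //; apply: mulr_gt0; [exact: mulr_gt0 | exact: addr_gt0].
rewrite ltNge => /negP; apply; apply: le_trans (_ : _ <= 0 + 0) _; last by rewrite addr0.
apply: le_trans (lerD H1 H2).
rewrite le_eqVlt; apply/orP; left; apply/eqP.
transitivity (r c * (2 * k * (t c + r c)) +
    r c * (t c * a0 c - 2 * s c * a1 c + r c * b1 c) +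
    (1 - (r c * t c - s c ^+ 2)) * (a0 c + 2 * k)).
  by rewrite det1 E subrr mulr0 mul0r !addr0.
ring.
Qed.
End MaximumPrinciple.

(** * Algebra of holomorphic functions for a unimodular metric *)

Section Conjugacy.
Variable R : realType.
Notation plane := 'rV[R]_2.

(* [u + i v] is holomorphic for the conformal structure of the unimodular metric
   [r dx^2 + 2 s dx dy + t dy^2] iff the gradients [(a, b)] of [u] and [(c, d)]
   of [v] satisfy these Cauchy-Riemann equations. *)
Definition cauchy_riemann (r s t a b c d : R) :=
  c = s * a - r * b /\ d = t * a - s * b.

Lemma cauchy_riemannD r s t a b c d a' b' c' d' :
  cauchy_riemann r s t a b c d -> cauchy_riemann r s t a' b' c' d' ->
  cauchy_riemann r s t (a + a') (b + b') (c + c') (d + d').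
Proof. by move=> [-> ->] [-> ->]; split; ring. Qed.

(** The equations read [(c, d) = J (a, b)] with [J^2 = -(r t - s^2)]. Unimodularity makes [J] a
    complex structure, so multiplication of the differential by [p + i q] preserves them. *)
Lemma cauchy_riemannM r s t a b c d p q : r * t - s ^+ 2 = 1 ->
  cauchy_riemann r s t a b c d ->
  cauchy_riemann r s t (p * a - q * c) (p * b - q * d)
                       (p * c + q * a) (p * d + q * b).
Proof.
move=> det1 [-> ->]; split; [rewrite -[q * a]mul1r | rewrite -[q * b]mul1r]; rewrite -det1; ring.
Qed.

Variables r s t : plane -> R.
Hypothesis det1 : forall x, r x * t x - s x ^+ 2 = 1.
Implicit Types (D : set plane) (u v a b c d : plane -> R) (x : plane).

(** The gradients must be differentiable as functions because the maximum principle involves second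
    derivatives. *)
Definition holomorphic D u v := exists a b c d,
  forall x, D x ->
  [/\ grad_at u x (a x) (b x), grad_at v x (c x) (d x),
      cauchy_riemann (r x) (s x) (t x) (a x) (b x) (c x) (d x) &
      [/\ differentiable a x, differentiable b x,
          differentiable c x & differentiable d x]].

Lemma grad_differentiable u x (a b : R) : grad_at u x a b -> differentiable u x.
Proof. by case. Qed.

Lemma differentiable_grad u x :
  differentiable u x -> grad_at u x (partial 0 u x) (partial 1 u x).
Proof. by []. Qed.

Lemma differentiable_funM u v x : differentiable u x -> differentiable v x ->
  differentiable (fun y => u y * v y) x.
Proof. exact: differentiableM. Qed.

Lemma differentiable_funB u v x : differentiable u x -> differentiable v x ->
  differentiable (fun y => u y - v y) x.
Proof. exact: differentiableB. Qed.

Lemma differentiable_funD u v x : differentiable u x -> differentiable v x ->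
  differentiable (fun y => u y + v y) x.
Proof. exact: differentiableD. Qed.

Lemma holomorphicS D D' u v : D' `<=` D -> holomorphic D u v -> holomorphic D' u v.
Proof. by move=> DD' [a [b [c [d H]]]]; exists a, b, c, d => x /DD'; exact: H. Qed.

Lemma holomorphic_cst D (k l : R) : holomorphic D (fun=> k) (fun=> l).
Proof.
exists (fun=> 0), (fun=> 0), (fun=> 0), (fun=> 0) => x _.
have dc : differentiable (fun=> 0 : R) x by exact: differentiable_cst.
split; [exact: grad_cst|exact: grad_cst| |by split].
by split; rewrite !mulr0 subrr.
Qed.

Lemma holomorphicD D u v u' v' : holomorphic D u v -> holomorphic D u' v' ->
  holomorphic D (fun x => u x + u' x) (fun x => v x + v' x).
Proof.
move=> [a [b [c [d H]]]] [a' [b' [c' [d' H']]]].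
exists (fun x => a x + a' x), (fun x => b x + b' x),
  (fun x => c x + c' x), (fun x => d x + d' x) => x Dx.
have [gu gv cr [da db dc dd]] := H x Dx.
have [gu' gv' cr' [da' db' dc' dd']] := H' x Dx.
split; [exact: gradD|exact: gradD|exact: cauchy_riemannD|].
by split; exact: differentiableD.
Qed.

(** Multiplication by [-i]: it turns the imaginary part into a real part. *)
Lemma holomorphic_mulNi D u v : holomorphic D u v ->
  holomorphic D v (fun x => - u x).
Proof.
move=> [a [b [c [d H]]]].
exists c, d, (fun x => - a x), (fun x => - b x) => x Dx.
have [gu gv cr [da db dc dd]] := H x Dx.
split=> //; first exact: gradN; last by split=> //; exact: differentiableN.
have [] := cauchy_riemannM 0 (- 1) (det1 x) cr.
by rewrite !mul0r !mulN1r !opprK !add0r.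
Qed.

Lemma holomorphicN D u v : holomorphic D u v ->
  holomorphic D (fun x => - u x) (fun x => - v x).
Proof. by move=> /holomorphic_mulNi/holomorphic_mulNi. Qed.

Lemma holomorphicM D u v u' v' : holomorphic D u v -> holomorphic D u' v' ->
  holomorphic D (fun x => u x * u' x - v x * v' x)
                (fun x => u x * v' x + v x * u' x).
Proof.
move=> [a [b [c [d H]]]] [a' [b' [c' [d' H']]]].
exists (fun x => (u x * a' x - v x * c' x) + (u' x * a x - v' x * c x)),
  (fun x => (u x * b' x - v x * d' x) + (u' x * b x - v' x * d x)),
  (fun x => (u x * c' x + v x * a' x) + (u' x * c x + v' x * a x)),
  (fun x => (u x * d' x + v x * b' x) + (u' x * d x + v' x * b x)) => x Dx.
have [gu gv cr [da db dc dd]] := H x Dx.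
have [gu' gv' cr' [da' db' dc' dd']] := H' x Dx.
have du := grad_differentiable gu; have dv := grad_differentiable gv.
have du' := grad_differentiable gu'; have dv' := grad_differentiable gv'.
split.
- by apply: (grad_eq (gradB (gradM gu gu') (gradM gv gv'))); ring.
- by apply: (grad_eq (gradD (gradM gu gv') (gradM gv gu'))); ring.
- by apply: cauchy_riemannD; exact: cauchy_riemannM.
by split; apply: differentiable_funD;
  (apply: differentiable_funB || apply: differentiable_funD);
  exact: differentiable_funM.
Qed.

Lemma holomorphicV D u v : (forall x, D x -> u x ^+ 2 + v x ^+ 2 != 0) ->
  holomorphic D u v ->
  holomorphic D (fun x => u x / (u x ^+ 2 + v x ^+ 2))
                (fun x => - v x / (u x ^+ 2 + v x ^+ 2)).
Proof.
move=> N0 [a [b [c [d H]]]].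
pose N x := u x * u x + v x * v x.
have NE x : u x ^+ 2 + v x ^+ 2 = N x by rewrite /N !expr2.
have -> : (fun x => u x / (u x ^+ 2 + v x ^+ 2)) = (fun x => u x * (N x)^-1).
  by apply/funext => x; rewrite NE.
have -> : (fun x => - v x / (u x ^+ 2 + v x ^+ 2)) = (fun x => - v x * (N x)^-1).
  by apply/funext => x; rewrite NE.
(* [p + i q] is [-1 / (u + i v)^2], the factor in the derivative of the reciprocal. *)
pose p x := (v x * v x - u x * u x) * ((N x)^-1 * (N x)^-1).
pose q x := (u x * v x + u x * v x) * ((N x)^-1 * (N x)^-1).
exists (fun x => p x * a x - q x * c x), (fun x => p x * b x - q x * d x),
  (fun x => p x * c x + q x * a x), (fun x => p x * d x + q x * b x) => x Dx.
have [gu gv cr [da db dc dd]] := H x Dx.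
have du := grad_differentiable gu; have dv := grad_differentiable gv.
have Nx : N x != 0 by rewrite -NE N0.
have gN : grad_at N x _ _ := gradD (gradM gu gu) (gradM gv gv).
have gV := gradV Nx gN.
split.
- by apply: (grad_eq (gradM gu gV)); rewrite /p /q /N; field; exact: Nx.
- by apply: (grad_eq (gradM (gradN gv) gV)); rewrite /p /q /N; field; exact: Nx.
- exact: cauchy_riemannM.
have dV := grad_differentiable gV.
have dp : differentiable p x by apply: differentiable_funM;
  [apply: differentiable_funB|]; exact: differentiable_funM.
have dq : differentiable q x by apply: differentiable_funM;
  [apply: differentiable_funD|]; exact: differentiable_funM.
by split; (apply: differentiable_funB || apply: differentiable_funD);
  exact: differentiable_funM.
Qed.

End Conjugacy.

(** * Vanishing of holomorphic functions that tend to 0 at 0 and at infinity *)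

Section Liouville.
Variable R : realType.
Notation plane := 'rV[R]_2.
Implicit Types (u v a b : plane -> R) (x : plane).

(** By the mean value theorem on the segment from 0 to [x], [u x] is [x] paired with the gradient at
    an intermediate point, and a gradient vanishing and differentiable at 0 is of order [|x|] there.
    No second-order Taylor formula is involved. *)
Lemma quadratic_bound u a b (a0 a1 b0 b1 : R) :
  (forall x, grad_at u x (a x) (b x)) -> u 0 = 0 -> a 0 = 0 -> b 0 = 0 ->
  grad_at a 0 a0 a1 -> grad_at b 0 b0 b1 ->
  exists2 C : R, 0 < C & exists2 d : R, 0 < d &
    forall x, `|x| < d -> `|u x| <= C * `|x| ^+ 2.
Proof.
have linear_bound f (f0 f1 : R) : f 0 = 0 -> grad_at f 0 f0 f1 ->
    exists2 C : R, 0 < C & exists2 d : R, 0 < d &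
      forall x, `|x| < d -> `|f x| <= C * `|x|.
  move=> f00 gf; have [d d0 H] := grad_bound gf ltr01.
  exists (1 + (`|f0| + `|f1|)); first by rewrite ltr_wpDr // addr_ge0.
  exists d => // x /H; rewrite add0r f00 subr0 mul1r => Hx.
  rewrite -[f x](subrK (x 0 0 * f0 + x 0 1 * f1)) (le_trans (ler_normD _ _)) //.
  rewrite mulrDl mul1r lerD // (le_trans (ler_normD _ _)) // !normrM mulrDl.
  by rewrite lerD // mulrC ler_wpM2l // norm_coord_le.
move=> gu u0 a_0 b_0 ga gb.
have [A A0 [d1 d10 H1]] := linear_bound a a0 a1 a_0 ga.
have [B B0 [d2 d20 H2]] := linear_bound b b0 b1 b_0 gb.
exists (A + B); first exact: addr_gt0.
exists (Num.min d1 d2); first by rewrite lt_min d10.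
move=> x; rewrite lt_min => /andP[x1 x2].
have [c] := MVT_abs (a := 0) (b := 1) (fun t _ => is_derive_line (gu (0 + t *: x))).
rewrite !subr0 normr1 => c1; rewrite !add0r scale1r scale0r u0 subr0 mul1r => ->.
have cx : `|c *: x| <= `|x| by rewrite normrZ ler_piMl.
have {}H1 := H1 _ (le_lt_trans cx x1); have {}H2 := H2 _ (le_lt_trans cx x2).
rewrite (le_trans (ler_normD _ _)) // !normrM mulrDl lerD //.
  rewrite expr2 mulrA mulrC ler_pM // ?norm_coord_le //.
  by rewrite (le_trans H1) // ler_wpM2l // ltW.
rewrite expr2 mulrA mulrC ler_pM // ?norm_coord_le //.
by rewrite (le_trans H2) // ler_wpM2l // ltW.
Qed.

Variables r s t : plane -> R.
Hypothesis det1 : forall x, r x * t x - s x ^+ 2 = 1.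
Hypothesis r_gt0 : forall x, 0 < r x.
Hypothesis dr : forall x, differentiable r x.
Hypothesis ds : forall x, differentiable s x.
Hypothesis dt : forall x, differentiable t x.
Hypothesis r_closed : forall x, partial 1 r x = partial 0 s x.
Hypothesis t_closed : forall x, partial 0 t x = partial 1 s x.

(** Equality of the mixed partials of the conjugate [v] is the Laplace equation for [u] in
    divergence form. Its first-order terms have coefficients [t_0 - s_1] and [r_1 - s_0], which
    vanish: the coordinates themselves are harmonic. *)
Lemma holomorphic_laplace u v a b x (d : R) c e : 0 < d ->
  (forall y, `|y - x| < d ->
    [/\ grad_at u y (a y) (b y), grad_at v y (c y) (e y) &
        cauchy_riemann (r y) (s y) (t y) (a y) (b y) (c y) (e y)]) ->
  differentiable a x -> differentiable b x ->
  t x * partial 0 a x - 2 * s x * partial 1 a x + r x * partial 1 b x = 0.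
Proof.
move=> d0 H da db.
have gr := differentiable_grad (dr x); have gs := differentiable_grad (ds x).
have gt := differentiable_grad (dt x).
have ga := differentiable_grad da; have gb := differentiable_grad db.
have gu y : `|y - x| < d -> grad_at u y (a y) (b y) by move=> /H[].
have gv y : `|y - x| < d ->
    grad_at v y (s y * a y - r y * b y) (t y * a y - s y * b y).
  by move=> /H[_ + [<- <-]].
have ab := young d0 gu ga gb.
have := young d0 gv (gradB (gradM gs ga) (gradM gr gb)) (gradB (gradM gt ga) (gradM gs gb)).
rewrite r_closed t_closed ab => /eqP; rewrite -subr_eq0 => /eqP E.
move: E; move: (partial 0 a x) (partial 0 b x) (partial 1 b x).
move: (partial 1 s x) (partial 0 s x) (r x) (s x) (t x) (a x) (b x) => k l m n o p q w y z E.
by apply/eqP; rewrite -oppr_eq0; apply/eqP; rewrite -[RHS]E; ring.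
Qed.

Lemma holomorphic_le0 u v : holomorphic r s t [set x | x != 0] u v ->
  (exists2 M : R, 0 < M & exists2 d : R, 0 < d &
     forall x, `|x| < d -> `|u x| <= M * `|x|) ->
  (exists K : R, forall x, `|x| * `|u x| <= K) ->
  forall x, u x <= 0.
Proof.
move=> [a [b [c [e H]]]] [M M0 [d d0 near0]] [K nearoo].
apply: (@elliptic_max_principle R r s t u a b (partial 0 a) (partial 1 a)
  (partial 0 b) (partial 1 b) det1 r_gt0).
- move=> x x0; have [gu gv cr [da db _ _]] := H x x0.
  split=> //; apply: (@holomorphic_laplace u v a b x `|x| c e) => //.
    by rewrite normr_gt0.
  move=> y yx; have [|gu' gv' cr' _] := H y; last by split.
  by apply/eqP => y0; move: yx; rewrite y0 sub0r normrN ltxx.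
- have := near0 0; rewrite normr0 mulr0 => /(_ d0).
  by rewrite normr_le0 => /eqP.
- move=> z z0; exists (Num.min d (z / M)); first by rewrite lt_min d0 divr_gt0.
  move=> x; rewrite lt_min => /andP[/near0 xd]; rewrite ltr_pdivlMr // mulrC => xz.
  by rewrite (le_trans xd) // ltW.
move=> z z0; exists (Num.max 0 (K / z)) => x; rewrite gt_max => /andP[x0 xK].
rewrite -(ler_pM2l x0) (le_trans (nearoo x)) //.
by move: xK; rewrite ltr_pdivrMr // => /ltW.
Qed.

(** The one-sided bound is applied to [u], [-u], [v], [-v], the real parts of the function
    multiplied by [1], [-1], [-i], [i]. *)
Lemma holomorphic_eq0 u v : holomorphic r s t [set x | x != 0] u v ->
  (exists2 M : R, 0 < M & exists2 d : R, 0 < d &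
     forall x, `|x| < d -> `|u x| <= M * `|x| /\ `|v x| <= M * `|x|) ->
  (exists K : R, forall x, `|x| * `|u x| <= K /\ `|x| * `|v x| <= K) ->
  forall x, u x = 0 /\ v x = 0.
Proof.
move=> huv [M M0 [d d0 near0]] [K nearoo].
have H w w' : holomorphic r s t [set x | x != 0] w w' ->
    (forall x, `|w x| = `|u x|) \/ (forall x, `|w x| = `|v x|) ->
    forall x, w x <= 0.
  move=> hw wE; apply: (holomorphic_le0 hw).
    by exists M => //; exists d => // x /near0[]; case: wE => ->.
  by exists K => x; have [] := nearoo x; case: wE => ->.
have hvu := holomorphic_mulNi det1 huv.
move=> x; split; apply/eqP; rewrite eq_le.
  rewrite (H _ _ huv) /=; last by left.
  rewrite -oppr_le0; apply: (H _ _ (holomorphicN det1 huv)).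
  by left => y; rewrite normrN.
rewrite (H _ _ hvu) /=; last by right.
rewrite -oppr_le0; apply: (H _ _ (holomorphicN det1 hvu)).
by right => y; rewrite normrN.
Qed.

End Liouville.

(** * The quotient with numerator squared and denominator cubed *)

Section Jorgens.
Variable R : realType.
Notation plane := 'rV[R]_2.
Implicit Types (x : plane).

Lemma norm2_plane x : `|x| ^+ 2 <= x 0 0 ^+ 2 + x 0 1 ^+ 2.
Proof.
set N := (X in _ <= X); have N0 : 0 <= N by rewrite addr_ge0 ?sqr_ge0.
rewrite -[N]sqr_sqrtr // ler_pXn2r ?nnegrE ?sqrtr_ge0 //.
by apply: norm_plane_le; rewrite -sqrtr_sqr ler_wsqrtr // (lerDl, lerDr) sqr_ge0.
Qed.

Lemma sqr_norm_le (a b : R) : 0 <= b -> a ^+ 2 <= b ^+ 2 -> `|a| <= b.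
Proof.
by move=> b0; rewrite -(real_normK (num_real a)) ler_pXn2r ?nnegrE.
Qed.

(* The vanishing criterion is applied to the holomorphic function
   [(g1 + i g2)^2 / (z1 + i z2)^3]. *)
Lemma holomorphic_quotient_eq0 (r s t g1 g2 z1 z2 : plane -> R) :
  (forall x, r x * t x - s x ^+ 2 = 1) -> (forall x, 0 < r x) ->
  (forall x, differentiable r x) -> (forall x, differentiable s x) ->
  (forall x, differentiable t x) ->
  (forall x, partial 1 r x = partial 0 s x) ->
  (forall x, partial 0 t x = partial 1 s x) ->
  holomorphic r s t setT g1 g2 -> holomorphic r s t setT z1 z2 ->
  (forall x, `|x| ^+ 2 <= z1 x ^+ 2 + z2 x ^+ 2) ->
  (exists2 K : R, 0 < K &
    forall x, g1 x ^+ 2 + g2 x ^+ 2 <= K ^+ 2 * (z1 x ^+ 2 + z2 x ^+ 2)) ->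
  (exists2 C : R, 0 < C & exists2 d : R, 0 < d & forall x, `|x| < d ->
    g1 x ^+ 2 + g2 x ^+ 2 <= (C * `|x| ^+ 2) ^+ 2) ->
  forall x, g1 x = 0 /\ g2 x = 0.
Proof.
move=> det1 r0 dr ds dt rcl tcl hg hz zx [K K0 gz] [C C0 [d d0 gC]].
have Dsub : [set x : plane | x != 0] `<=` setT by [].
have N0 x : [set x : plane | x != 0] x -> z1 x ^+ 2 + z2 x ^+ 2 != 0.
  move=> /= x0; rewrite gt_eqF // (lt_le_trans _ (zx x)) // exprn_gt0 //.
  by rewrite normr_gt0.
have hi := holomorphicV det1 N0 (holomorphicS Dsub hz).
have hgi := holomorphicM det1 (holomorphicS Dsub hg) hi.
have hY := holomorphicM det1 (holomorphicM det1 hgi hgi) hi.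
move: hY; set Y1 := (X in holomorphic _ _ _ _ X _) => hY.
set Y2 := (X in holomorphic _ _ _ _ _ X) in hY.
have NY x : x != 0 -> (Y1 x ^+ 2 + Y2 x ^+ 2) * (z1 x ^+ 2 + z2 x ^+ 2) ^+ 3 =
    (g1 x ^+ 2 + g2 x ^+ 2) ^+ 2.
  by move=> x0; rewrite /Y1 /Y2; field; exact: N0.
have Nz x : x != 0 -> 0 < z1 x ^+ 2 + z2 x ^+ 2.
  by move=> x0; rewrite lt_neqAle eq_sym N0 // addr_ge0 ?sqr_ge0.
have NY0 x : 0 <= Y1 x ^+ 2 + Y2 x ^+ 2 by rewrite addr_ge0 ?sqr_ge0.
have Ng0 x : 0 <= g1 x ^+ 2 + g2 x ^+ 2 by rewrite addr_ge0 ?sqr_ge0.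
have g0 : g1 0 = 0 /\ g2 0 = 0.
  have := gC 0; rewrite normr0 expr0n mulr0 expr0n => /(_ d0) g00.
  have /andP[] : (g1 0 ^+ 2 == 0) && (g2 0 ^+ 2 == 0).
    by rewrite -paddr_eq0 ?sqr_ge0 // eq_le g00 Ng0.
  by rewrite !sqrf_eq0 => /eqP -> /eqP ->.
(* Whatever value the inverse of [z1 + i z2] takes at 0, the factors [g1] and [g2] vanish there. *)
have Y0 : Y1 0 = 0 /\ Y2 0 = 0.
  by rewrite /Y1 /Y2 g0.1 g0.2; split; ring.
have split_bound x (B : R) : 0 <= B -> Y1 x ^+ 2 + Y2 x ^+ 2 <= B ^+ 2 ->
    `|Y1 x| <= B /\ `|Y2 x| <= B.
  move=> B0 H; split; apply: sqr_norm_le => //; apply: le_trans H.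
    by rewrite lerDl sqr_ge0.
  by rewrite lerDr sqr_ge0.
have nearY x : `|x| < d -> `|Y1 x| <= C ^+ 2 * `|x| /\ `|Y2 x| <= C ^+ 2 * `|x|.
  move=> xd; have [->|x0] := eqVneq x 0.
    by rewrite Y0.1 Y0.2 !normr0 mulr0 lexx.
  apply: split_bound; first by rewrite mulr_ge0 // sqr_ge0.
  rewrite -(ler_pM2r (exprn_gt0 3 (Nz x x0))) NY //.
  (* The middle term is [C^4 |x|^8]: it bounds [|g|^4], and trading [|x|^6] for [|z|^6] gives the
     bound for the quotient. *)
  apply: (@le_trans _ _ ((C ^+ 2 * `|x|) ^+ 2 * (`|x| ^+ 2) ^+ 3)).
    rewrite (_ : _ * _ = ((C * `|x| ^+ 2) ^+ 2) ^+ 2); last by ring.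
    by rewrite ler_pXn2r ?nnegrE ?sqr_ge0 // gC.
  by rewrite ler_wpM2l ?sqr_ge0 // ler_pXn2r ?nnegrE ?sqr_ge0 ?(ltW (Nz x x0)).
have farY x : `|x| * `|Y1 x| <= K ^+ 2 /\ `|x| * `|Y2 x| <= K ^+ 2.
  have [->|x0] := eqVneq x 0; first by rewrite normr0 !mul0r sqr_ge0.
  have nx : 0 < `|x| by rewrite normr_gt0.
  rewrite -!ler_pdivlMl //; apply: split_bound.
    by rewrite mulr_ge0 ?invr_ge0 ?sqr_ge0.
  rewrite -(ler_pM2r (exprn_gt0 3 (Nz x x0))) NY //.
  apply: (@le_trans _ _ ((K ^+ 2 * (z1 x ^+ 2 + z2 x ^+ 2)) ^+ 2)).
    by rewrite ler_pXn2r ?nnegrE ?gz // mulr_ge0 ?sqr_ge0 ?(ltW (Nz x x0)).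
  set Z := z1 x ^+ 2 + z2 x ^+ 2.
  rewrite (_ : (`|x|^-1 * K ^+ 2) ^+ 2 * Z ^+ 3 =
    (K ^+ 2 * Z) ^+ 2 * (`|x|^-1 ^+ 2 * Z)); last by ring.
  rewrite ler_peMr ?sqr_ge0 // exprVn mulrC ler_pdivlMr ?exprn_gt0 // mul1r.
  exact: zx.
have Yeq0 := holomorphic_eq0 det1 r0 dr ds dt rcl tcl hY.
have {}Yeq0 x : Y1 x = 0 /\ Y2 x = 0.
  apply: Yeq0.
    by exists (C ^+ 2); [exact: exprn_gt0|exists d].
  by exists (K ^+ 2).
move=> x; have [->|x0] := eqVneq x 0; first exact: g0.
have := NY x x0; rewrite (Yeq0 x).1 (Yeq0 x).2 expr0n addr0 mul0r => /esym/eqP.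
rewrite sqrf_eq0 paddr_eq0 ?sqr_ge0 // !sqrf_eq0 => /andP[/eqP -> /eqP ->].
by [].
Qed.

End Jorgens.

(** * Unimodular positive Hessians on the plane are constant *)

Section UnimodularHessian.
Variable R : realType.
Notation plane := 'rV[R]_2.
Implicit Types (x : plane).

Variables r s t : plane -> R.
Hypothesis det1 : forall x, r x * t x - s x ^+ 2 = 1.
Hypothesis r_gt0 : forall x, 0 < r x.
Hypothesis dr : forall x, differentiable r x.
Hypothesis ds : forall x, differentiable s x.
Hypothesis dt : forall x, differentiable t x.
Hypothesis r_closed : forall x, partial 1 r x = partial 0 s x.
Hypothesis t_closed : forall x, partial 0 t x = partial 1 s x.

(** Along the ray through [x] the derivative is the quadratic form of [(r, s; s, t)] at [x],
    positive by completing the square. *)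
Lemma gradient_monotone F G : F 0 = 0 -> G 0 = 0 ->
  (forall x, grad_at F x (r x) (s x)) -> (forall x, grad_at G x (s x) (t x)) ->
  forall x, 0 <= x 0 0 * F x + x 0 1 * G x.
Proof.
move=> F0 G0 gF gG x.
have gp y : grad_at (fun y => x 0 0 * F y + x 0 1 * G y) y
    (x 0 0 * r y + x 0 1 * s y) (x 0 0 * s y + x 0 1 * t y).
  by apply: gradD; exact: gradMl.
have [c _] := MVT_abs (a := 0) (b := 1) (fun t _ => is_derive_line (gp (0 + t *: x))).
rewrite scale1r scale0r !add0r F0 G0 !mulr0 addr0 !subr0 mul1r => ->.
move: (c *: x) => y; rewrite -(pmulr_rge0 _ (r_gt0 y)).
have -> : r y * (x 0 0 * (x 0 0 * r y + x 0 1 * s y) + x 0 1 * (x 0 0 * s y + x 0 1 * t y)) =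
    (r y * x 0 0 + s y * x 0 1) ^+ 2 + (r y * t y - s y ^+ 2) * x 0 1 ^+ 2 by ring.
by rewrite det1 mul1r addr_ge0 ?sqr_ge0.
Qed.

Lemma unimodular_hessian_cst :
  continuous (partial 0 s) -> continuous (partial 1 s) ->
  forall x, [/\ r x = r 0, s x = s 0 & t x = t 0].
Proof.
move=> cs0 cs1.
have gr x : grad_at r x (partial 0 r x) (partial 0 s x).
  by rewrite -r_closed; exact: differentiable_grad.
have gs x : grad_at s x (partial 0 s x) (partial 1 s x) by exact: differentiable_grad.
have gt x : grad_at t x (partial 1 s x) (partial 1 t x).
  by rewrite -t_closed; exact: differentiable_grad.
have [F F0 gF] := poincare gr gs cs0.
have [G G0 gG] := poincare gs gt cs1.
have gx := @grad_coord R 0; have gy := @grad_coord R 1.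
pose z1 x := x 0 0 + F x; pose z2 x := x 0 1 + G x.
pose e1 x := x 0 0 - F x; pose e2 x := G x - x 0 1.
have t_gt0 x : 0 < t x.
  rewrite -(pmulr_rgt0 _ (r_gt0 x)); have := det1 x; have := sqr_ge0 (s x).
  move: (r x * t x) (s x ^+ 2) => p q; lra.
have w0 : 0 < 2 + r 0 + t 0 by rewrite addr_gt0 // addr_gt0.
have w0n : 2 + r 0 + t 0 != 0 by rewrite gt_eqF.
(* [k1 + i k2] is the quotient [(1 - r + i s) / (1 + r + i s)] of the first partials of [e] and [z]
   at 0, simplified by [s^2 = r t - 1]. With it the gradients of [g1] and [g2] vanish at 0, as [c11]
   to [c22] confirm. *)
pose k1 := (t 0 - r 0) / (2 + r 0 + t 0).
pose k2 := 2 * s 0 / (2 + r 0 + t 0).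
have gz1 x : grad_at z1 x (1 + r x) (s x).
  by apply: (grad_eq (gradD (gx x) (gF x))); rewrite /= ?add0r.
have gz2 x : grad_at z2 x (s x) (1 + t x).
  by apply: (grad_eq (gradD (gy x) (gG x))); rewrite /= ?add0r.
have ge1 x : grad_at e1 x (1 - r x) (- s x).
  by apply: (grad_eq (gradB (gx x) (gF x))); rewrite /= ?add0r.
have ge2 x : grad_at e2 x (s x) (t x - 1).
  by apply: (grad_eq (gradB (gG x) (gy x))); rewrite /= ?subr0.
pose g1 x := e1 x - (k1 * z1 x - k2 * z2 x).
pose g2 x := e2 x - (k1 * z2 x + k2 * z1 x).
have gg1 x : grad_at g1 x (1 - r x - (k1 * (1 + r x) - k2 * s x))
    (- s x - (k1 * s x - k2 * (1 + t x))).
  by apply: gradB => //; apply: gradB; exact: gradMl.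
have gg2 x : grad_at g2 x (s x - (k1 * s x + k2 * (1 + r x)))
    (t x - 1 - (k1 * (1 + t x) + k2 * s x)).
  by apply: gradB => //; apply: gradD; exact: gradMl.
have d_cst (c : R) x : differentiable (fun=> c) x by exact: differentiable_cst.
have hz : holomorphic r s t setT z1 z2.
  exists (fun x => 1 + r x), s, s, (fun x => 1 + t x) => x _.
  split=> //; last by split=> //; exact: differentiable_funD.
  by split; [ring | rewrite -{1}(det1 x); ring].
have he : holomorphic r s t setT e1 e2.
  exists (fun x => 1 - r x), (fun x => - s x), s, (fun x => t x - 1) => x _.
  split=> //; last first.
    split=> //; [exact: differentiable_funB | exact: differentiableN |].
    exact: differentiable_funB.
  by split; [ring | rewrite -{1}(det1 x); ring].
have hg : holomorphic r s t setT g1 g2.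
  apply: (holomorphicD he); apply: (holomorphicN det1).
  exact: (holomorphicM det1 (holomorphic_cst r s t setT k1 k2) hz).
have mono := gradient_monotone F0 G0 gF gG.
have zx x : `|x| ^+ 2 <= z1 x ^+ 2 + z2 x ^+ 2.
  apply: le_trans (norm2_plane x) _; rewrite /z1 /z2.
  have := mono x; have := sqr_ge0 (F x); have := sqr_ge0 (G x).
  move: (x 0 0) (x 0 1) (F x) (G x) => p q u v; nra.
(* The difference of the two sides is four times the monotone pairing of [x] with [(F, G)]. *)
have ez x : e1 x ^+ 2 + e2 x ^+ 2 <= z1 x ^+ 2 + z2 x ^+ 2.
  rewrite /z1 /z2 /e1 /e2; have := mono x.
  move: (x 0 0) (x 0 1) (F x) (G x) => p q u v; nra.
have g10 : g1 0 = 0 by rewrite /g1 /e1 /z1 /z2 !mxE F0 G0; ring.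
have g20 : g2 0 = 0 by rewrite /g2 /e2 /z1 /z2 !mxE F0 G0; ring.
have Kpos : 0 < 2 * (1 + (k1 ^+ 2 + k2 ^+ 2)).
  by rewrite mulr_gt0 // ltr_wpDr // addr_ge0 ?sqr_ge0.
have gz x : g1 x ^+ 2 + g2 x ^+ 2 <=
    Num.sqrt (2 * (1 + (k1 ^+ 2 + k2 ^+ 2))) ^+ 2 * (z1 x ^+ 2 + z2 x ^+ 2).
  rewrite sqr_sqrtr ?(ltW Kpos) //.
  pose m1 := k1 * z1 x - k2 * z2 x; pose m2 := k1 * z2 x + k2 * z1 x.
  (* The constant comes from [|e - k z|^2 <= 2 |e|^2 + 2 |k|^2 |z|^2] and [|e| <= |z|]. *)
  have -> : 2 * (1 + (k1 ^+ 2 + k2 ^+ 2)) * (z1 x ^+ 2 + z2 x ^+ 2) =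
      2 * (z1 x ^+ 2 + z2 x ^+ 2) + 2 * (m1 ^+ 2 + m2 ^+ 2) by rewrite /m1 /m2; ring.
  have := ez x; rewrite /g1 /g2 -/m1 -/m2.
  have := sqr_ge0 (e1 x + m1); have := sqr_ge0 (e2 x + m2).
  move: (e1 x) (e2 x) m1 m2 (z1 x ^+ 2 + z2 x ^+ 2) => a b c d Z; nra.
have ed0 : r 0 * t 0 - s 0 ^+ 2 = 1 by exact: det1.
have c11 : 1 - r 0 - (k1 * (1 + r 0) - k2 * s 0) = 0.
  transitivity (2 / (2 + r 0 + t 0) * (1 - (r 0 * t 0 - s 0 ^+ 2))).
    by rewrite /k1 /k2; field.
  by rewrite ed0 subrr mulr0.
have c12 : - s 0 - (k1 * s 0 - k2 * (1 + t 0)) = 0.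
  by rewrite /k1 /k2; field.
have c21 : s 0 - (k1 * s 0 + k2 * (1 + r 0)) = 0.
  by rewrite /k1 /k2; field.
have c22 : t 0 - 1 - (k1 * (1 + t 0) + k2 * s 0) = 0.
  transitivity (- (2 / (2 + r 0 + t 0)) * (1 - (r 0 * t 0 - s 0 ^+ 2))).
    by rewrite /k1 /k2; field.
  by rewrite ed0 subrr mulr0.
have quad u (a b : plane -> R) : (forall x, grad_at u x (a x) (b x)) ->
    u 0 = 0 -> a 0 = 0 -> b 0 = 0 -> differentiable a 0 -> differentiable b 0 ->
    exists2 C : R, 0 < C & exists2 d : R, 0 < d &
      forall x, `|x| < d -> `|u x| <= C * `|x| ^+ 2.
  move=> gu u0 a0 b0 da db.
  exact: (quadratic_bound gu u0 a0 b0 (differentiable_grad da) (differentiable_grad db)).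
have [C1 C10 [d1 d10 H1]] : exists2 C : R, 0 < C & exists2 d : R, 0 < d &
    forall x, `|x| < d -> `|g1 x| <= C * `|x| ^+ 2.
  apply: (quad _ _ _ gg1 g10 c11 c12);
    by repeat first [exact: dr | exact: ds | exact: dt | exact: d_cst |
      apply: differentiable_funB | apply: differentiable_funM |
      apply: differentiable_funD | apply: differentiableN].
have [C2 C20 [d2 d20 H2]] : exists2 C : R, 0 < C & exists2 d : R, 0 < d &
    forall x, `|x| < d -> `|g2 x| <= C * `|x| ^+ 2.
  apply: (quad _ _ _ gg2 g20 c21 c22);
    by repeat first [exact: dr | exact: ds | exact: dt | exact: d_cst |
      apply: differentiable_funB | apply: differentiable_funM |
      apply: differentiable_funD | apply: differentiableN].
have gC : exists2 C : R, 0 < C & exists2 d : R, 0 < d & forall x, `|x| < d ->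
    g1 x ^+ 2 + g2 x ^+ 2 <= (C * `|x| ^+ 2) ^+ 2.
  exists (C1 + C2); first exact: addr_gt0.
  exists (Num.min d1 d2); first by rewrite lt_min d10.
  move=> x; rewrite lt_min => /andP[/H1 {}H1 /H2 {}H2].
  have := mulr_ge0 (mulr_ge0 (ltW C10) (sqr_ge0 `|x|)) (mulr_ge0 (ltW C20) (sqr_ge0 `|x|)).
  have sq (p q : R) : `|p| <= q -> p ^+ 2 <= q ^+ 2.
    by move=> pq; rewrite -(real_normK (num_real p)) ler_pXn2r ?nnegrE //
      (le_trans _ pq).
  have := lerD (sq _ _ H1) (sq _ _ H2); rewrite mulrDl.
  move: (C1 * `|x| ^+ 2) (C2 * `|x| ^+ 2) (g1 x ^+ 2 + g2 x ^+ 2) => p q N h1 h2.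
  nra.
have geq0 x : g1 x = 0 /\ g2 x = 0.
  apply: (holomorphic_quotient_eq0 det1 r_gt0 dr ds dt r_closed t_closed hg hz zx _ gC).
  by exists (Num.sqrt (2 * (1 + (k1 ^+ 2 + k2 ^+ 2)))) => //; rewrite sqrtr_gt0.
have g1E : g1 = fun=> 0 by apply/funext => x; exact: (geq0 x).1.
have g2E : g2 = fun=> 0 by apply/funext => x; exact: (geq0 x).2.
have E1 x : 1 - r x - (k1 * (1 + r x) - k2 * s x) = 0 /\
    - s x - (k1 * s x - k2 * (1 + t x)) = 0.
  by apply: grad_uniq (gg1 x) _; rewrite g1E; exact: grad_cst.
have E2 x : s x - (k1 * s x + k2 * (1 + r x)) = 0 /\
    t x - 1 - (k1 * (1 + t x) + k2 * s x) = 0.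
  by apply: grad_uniq (gg2 x) _; rewrite g2E; exact: grad_cst.
(* Up to sign this is the determinant of the linear systems for [(r, s)] and for [(s, t)] expressing
   that the gradient of [e - k z] vanishes; the combinations below are Cramer's rule. *)
have k_lt1 : 0 < 1 - k1 ^+ 2 - k2 ^+ 2.
  have -> : 1 - k1 ^+ 2 - k2 ^+ 2 = (4 * (1 + (r 0 * t 0 - s 0 ^+ 2)) + 4 * (r 0 + t 0)) /
      (2 + r 0 + t 0) ^+ 2.
    by rewrite /k1 /k2; field.
  rewrite ed0 divr_gt0 ?exprn_gt0 // addr_gt0 // mulr_gt0 //.
  exact: addr_gt0.
move=> x; have [e11 e12] := E1 x; have [e21 e22] := E2 x.
have kn0 : 1 - k1 ^+ 2 - k2 ^+ 2 != 0 by rewrite gt_eqF.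
have cancel0 p q : (1 - k1 ^+ 2 - k2 ^+ 2) * (p - q) = 0 -> p = q.
  by move/eqP; rewrite mulf_eq0 (negPf kn0) subr_eq0 => /eqP.
split; apply: cancel0.
- transitivity (- (1 - k1) * (1 - r x - (k1 * (1 + r x) - k2 * s x) -
      (1 - r 0 - (k1 * (1 + r 0) - k2 * s 0))) +
    k2 * (s x - (k1 * s x + k2 * (1 + r x)) - (s 0 - (k1 * s 0 + k2 * (1 + r 0))))).
    by ring.
  by rewrite e11 e21 c11 c21 subrr !mulr0 addr0.
- transitivity ((1 + k1) * (s x - (k1 * s x + k2 * (1 + r x)) -
      (s 0 - (k1 * s 0 + k2 * (1 + r 0)))) -
    k2 * (1 - r x - (k1 * (1 + r x) - k2 * s x) -
      (1 - r 0 - (k1 * (1 + r 0) - k2 * s 0)))).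
    by ring.
  by rewrite e11 e21 c11 c21 subrr !mulr0 subr0.
transitivity ((1 + k1) * (t x - 1 - (k1 * (1 + t x) + k2 * s x) -
      (t 0 - 1 - (k1 * (1 + t 0) + k2 * s 0))) -
    k2 * (- s x - (k1 * s x - k2 * (1 + t x)) -
      (- s 0 - (k1 * s 0 - k2 * (1 + t 0))))).
  by ring.
by rewrite e12 e22 c12 c22 subrr !mulr0 subr0.
Qed.

End UnimodularHessian.

(** * Closure properties of smooth functions, and shears *)

Section SmoothClosure.
Variable R : realType.
Notation plane := 'rV[R]_2.
Notation e_ i := (delta_mx 0 i : plane).

Lemma class_CS (V : normedModType R) k (F : plane -> V) :
  class_C k.+1 F -> class_C k F.
Proof.
elim: k F => [F [dF _] x|k IH F [dF pF]]; first exact: differentiable_continuous.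
by split=> // i; apply: IH; exact: pF.
Qed.

Lemma smooth_partial (V : normedModType R) (F : plane -> V) i :
  smooth F -> smooth (partial i F).
Proof. by move=> sF k; have [_] := sF k.+1; exact. Qed.

Lemma smooth_differentiable (V : normedModType R) (F : plane -> V) x :
  smooth F -> differentiable F x.
Proof. by move=> /(_ 1) []. Qed.

Lemma class_C_cst (V : normedModType R) k (v : V) : class_C k (fun _ : plane => v).
Proof.
elim: k v => [|k IH] v; first by move=> x; apply: cvg_cst; exact: nbhs_filter.
split=> [x|i]; first exact: differentiable_cst.
rewrite (_ : partial i _ = fun=> 0); first exact: IH.
by apply/funext => x; exact: derive_cst.
Qed.

Lemma class_CD k (f g : plane -> R) : class_C k f -> class_C k g ->
  class_C k (fun x => f x + g x).
Proof.
elim: k f g => [f g cf cg x|k IH f g [df pf] [dg pg]].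
  exact: cvgD (cf x) (cg x).
split=> [x|i]; first exact: differentiableD.
rewrite (_ : partial i _ = fun x => partial i f x + partial i g x).
  by apply: IH; [exact: pf | exact: pg].
by apply/funext => x; apply: deriveD; exact: diff_derivable.
Qed.

Lemma class_CM k (f g : plane -> R) : class_C k f -> class_C k g ->
  class_C k (fun x => f x * g x).
Proof.
elim: k f g => [f g cf cg x|k IH f g Cf Cg].
  exact: cvgM (cf x) (cg x).
have [df pf] := Cf; have [dg pg] := Cg.
split=> [x|i]; first exact: differentiableM.
rewrite (_ : partial i _ = fun x => f x * partial i g x + g x * partial i f x).
  by apply: class_CD; apply: IH; by [exact: pf | exact: pg | exact: class_CS].
by apply/funext => x; apply: deriveM; exact: diff_derivable.
Qed.

Lemma class_C_sum k n (f : 'I_n -> plane -> R) : (forall i, class_C k (f i)) ->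
  class_C k (fun x => \sum_(i < n) f i x).
Proof.
elim: n f => [|n IH] f Cf.
  by under eq_fun do rewrite big_ord0; exact: class_C_cst.
under eq_fun do rewrite big_ord_recr /=.
by apply: class_CD => //; exact: IH.
Qed.

Lemma differentiable_entry n (f : plane -> 'rV[R]_n) x j :
  differentiable f x -> differentiable (fun y => f y 0 j) x.
Proof.
move=> df; apply: (@differentiable_comp _ _ _ _ f (fun v : 'rV[R]_n => v 0 j)) => //.
exact: differentiable_coord.
Qed.

Lemma derive_entry n (f : plane -> 'rV[R]_n) x v j :
  derivable f x v -> 'D_v (fun y => f y 0 j) x = 'D_v f x 0 j.
Proof. by move=> df; rewrite (derive_mx df) mxE. Qed.

Lemma class_C_entry k n (f : plane -> 'rV[R]_n) j :
  class_C k f -> class_C k (fun x => f x 0 j).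
Proof.
elim: k f => [f cf x|k IH f [df pf]].
  by apply: (@continuous_comp _ _ _ f (fun v : 'rV[R]_n => v 0 j));
    [exact: cf | exact: coord_continuous].
split=> [x|i]; first exact: differentiable_entry.
rewrite (_ : partial i _ = fun x => partial i f x 0 j).
  by apply: IH; exact: pf.
by apply/funext => x; apply: derive_entry; exact: diff_derivable.
Qed.

Lemma smooth_minkowski n (P Q : plane -> 'rV[R]_n) : smooth P -> smooth Q ->
  smooth (fun x => minkowski (P x) (Q x)).
Proof.
move=> sP sQ k; apply: class_C_sum => i; apply: class_CM; first exact: class_C_cst.
by apply: class_CM; apply: class_C_entry.
Qed.

Lemma differentiable_lincomb (V : normedModType R) (v w : V) (x : plane) :
  differentiable (fun u : plane => u 0 0 *: v + u 0 1 *: w) x.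
Proof.
by apply: differentiableD; apply: differentiableZl; exact: differentiable_coord.
Qed.

Lemma smooth_lincomb (V : normedModType R) (v w : V) :
  smooth (fun u : plane => u 0 0 *: v + u 0 1 *: w).
Proof.
move=> [|k]; first by move=> x; exact/differentiable_continuous/differentiable_lincomb.
split=> [x|i]; first exact: differentiable_lincomb.
rewrite (_ : partial i _ = fun=> (e_ i) 0 0 *: v + (e_ i) 0 1 *: w).
  exact: class_C_cst.
apply/funext => x; rewrite /partial /derive.
apply: cvg_lim => //; apply: cvg_near_cst; near=> h.
have h0 : h != 0 by near: h; exact: nbhs_dnbhs_neq.
rewrite /= !mxE !scalerDl opprD addrACA !addrK -!scalerA -scalerDr scalerA.
by rewrite mulVf // scale1r.
Unshelve. all: by end_near. Qed.

Lemma shearE (a b : R) :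
  shear a b = fun u => u 0 0 *: (e_ 0 + a *: e_ 1) + u 0 1 *: (b *: e_ 1).
Proof.
apply/funext => u; rewrite [LHS]plane_basis [RHS]plane_basis.
by congr (_ *: _ + _ *: _); rewrite !mxE !eqxx /=; ring.
Qed.

Lemma smooth_shear (a b : R) : smooth (shear a b).
Proof. by rewrite shearE; exact: smooth_lincomb. Qed.

Lemma derive_shear (V : normedModType R) (F : plane -> V) a b u v :
  'D_v (F \o shear a b) u = 'D_(shear a b v) F (shear a b u).
Proof.
have E : (fun h : R => h^-1 *: (((F \o shear a b) \o shift u) (h *: v) -
      (F \o shear a b) u)) =
    (fun h : R => h^-1 *: ((F \o shift (shear a b u)) (h *: shear a b v) -
      F (shear a b u))).
  apply/funext => h /=; congr (_ *: (F _ - _)); rewrite shearE.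
  by apply/rowP => i; rewrite !mxE; ring.
by rewrite /derive E.
Qed.

(** A partial of the composite is a combination, with constant coefficients, of partials of [F]
    composed with the same shear, so the induction closes. *)
Lemma class_C_comp_shear k (F : plane -> R) a b :
  class_C k F -> class_C k (F \o shear a b).
Proof.
elim: k F => [F cF x|k IH F [dF pF]].
  by apply: continuous_comp; [exact: (smooth_shear a b 0%N) | exact: cF].
split=> [x|i].
  by apply: differentiable_comp => //; exact/smooth_differentiable/smooth_shear.
rewrite (_ : partial i _ = fun x =>
    (shear a b (e_ i) 0 0 * (partial 0 F \o shear a b) x) +
    (shear a b (e_ i) 0 1 * (partial 1 F \o shear a b) x)).
  by apply: class_CD; apply: class_CM;
    by [exact: class_C_cst | apply: IH; exact: pF].
apply/funext => x; rewrite [LHS]derive_shear deriveE //.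
exact: diff_grad (differentiable_grad (dF _)).
Qed.

Lemma shearK (a b : R) : b != 0 -> cancel (shear a b) (shear (- (a / b)) b^-1).
Proof.
move=> b0 u; rewrite -[RHS]ptE -[LHS]ptE; congr (pt _ _);
  by rewrite !mxE /=; field.
Qed.

Lemma shearKV (a b : R) : b != 0 -> cancel (shear (- (a / b)) b^-1) (shear a b).
Proof.
move=> b0 u; rewrite -[RHS]ptE -[LHS]ptE; congr (pt _ _);
  by rewrite !mxE /=; field.
Qed.

End SmoothClosure.

(** * Bilinearity and differentiation of the Minkowski product and of graphs *)

Section MinkowskiCalculus.
Variable R : realType.
Notation plane := 'rV[R]_2.

Lemma minkowskiC n (u v : 'rV[R]_n) : minkowski u v = minkowski v u.
Proof. by apply: eq_bigr => i _; rewrite [u 0 i * _]mulrC. Qed.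

Lemma minkowskiDl n (u v w : 'rV[R]_n) :
  minkowski (u + v) w = minkowski u w + minkowski v w.
Proof.
by rewrite /Defs.minkowski -big_split; apply: eq_bigr => i _; rewrite mxE /=; ring.
Qed.

Lemma minkowskiZl n k (u w : 'rV[R]_n) : minkowski (k *: u) w = k * minkowski u w.
Proof.
by rewrite /Defs.minkowski mulr_sumr; apply: eq_bigr => i _; rewrite mxE; ring.
Qed.

Lemma minkowski0l n (w : 'rV[R]_n) : minkowski 0 w = 0.
Proof. by rewrite -[X in minkowski X](scale0r 0) minkowskiZl mul0r. Qed.

Lemma minkowski_lincomb n (a b c d : R) (p q : 'rV[R]_n) :
  minkowski (a *: p + b *: q) (c *: p + d *: q) =
  a * c * minkowski p p + (a * d + b * c) * minkowski p q + b * d * minkowski q q.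
Proof.
rewrite minkowskiDl !minkowskiZl ![minkowski _ (_ + _)]minkowskiC.
by rewrite !minkowskiDl !minkowskiZl [minkowski q p]minkowskiC; ring.
Qed.

Lemma grad_sum n (f : 'I_n -> plane -> R) (a b : 'I_n -> R) x :
  (forall i, grad_at (f i) x (a i) (b i)) ->
  grad_at (fun y => \sum_(i < n) f i y) x (\sum_(i < n) a i) (\sum_(i < n) b i).
Proof.
elim: n f a b => [|n IH] f a b gf.
  under eq_fun do rewrite big_ord0.
  by rewrite !big_ord0; exact: grad_cst.
under eq_fun do rewrite big_ord_recr /=.
by rewrite !big_ord_recr /=; apply: gradD => //; apply: IH.
Qed.

Lemma grad_entry n (S : plane -> 'rV[R]_n) x i : differentiable S x ->
  grad_at (fun y => S y 0 i) x (partial 0 S x 0 i) (partial 1 S x 0 i).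
Proof.
move=> dS; split; first exact: differentiable_entry.
  by apply: derive_entry; exact: diff_derivable.
by apply: derive_entry; exact: diff_derivable.
Qed.

Lemma grad_minkowski n (P Q : plane -> 'rV[R]_n) x :
  differentiable P x -> differentiable Q x ->
  grad_at (fun y => minkowski (P y) (Q y)) x
    (minkowski (partial 0 P x) (Q x) + minkowski (P x) (partial 0 Q x))
    (minkowski (partial 1 P x) (Q x) + minkowski (P x) (partial 1 Q x)).
Proof.
move=> dP dQ.
apply: (grad_eq (grad_sum (fun i => gradMl ((-1) ^+ (i.+1 == n)) (gradM (grad_entry i dP) (grad_entry i dQ))))).
  by rewrite -big_split; apply: eq_bigr => i _ /=; ring.
by rewrite -big_split; apply: eq_bigr => i _ /=; ring.
Qed.

Lemma grad_comp (g : R -> R) (f : plane -> R) x (a b k : R) :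
  is_derive (f x) 1 g k -> grad_at f x a b ->
  grad_at (fun y => g (f y)) x (k * a) (k * b).
Proof.
move=> [dg gk] gf; have [df _ _] := gf.
have dg' : differentiable g (f x) by exact/derivable1_diffP.
have D v : 'D_v (g \o f) x = k * 'd f x v.
  rewrite deriveE; last exact: differentiable_comp.
  rewrite diff_comp //= deriv1E // derive1E gk.
  by rewrite /GRing.scale /= mulrC.
split; first exact: differentiable_comp.
  by rewrite [LHS]D (diff_grad _ gf) !mxE eqxx /=; ring.
by rewrite [LHS]D (diff_grad _ gf) !mxE eqxx /=; ring.
Qed.

Lemma derive_row_mx n m (g : plane -> 'rV[R]_n) (h : plane -> 'rV[R]_m) x v :
  derivable g x v -> derivable h x v ->
  'D_v (fun y => row_mx (g y) (h y)) x = row_mx ('D_v g x) ('D_v h x).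
Proof.
move=> dg dh.
have dgh : derivable (fun y => row_mx (g y) (h y)) x v.
  apply/derivable_mxP => i j; rewrite ord1 -(fintype.splitK j).
  case: (fintype.split j) => c.
    rewrite (_ : (fun _ => _) = (fun y => g y 0 c)); last first.
      by apply/funext => y; rewrite row_mxEl.
    by have /derivable_mxP := dg; exact.
  rewrite (_ : (fun _ => _) = (fun y => h y 0 c)); last first.
    by apply/funext => y; rewrite row_mxEr.
  by have /derivable_mxP := dh; exact.
apply/rowP => j; rewrite -derive_entry // -(fintype.splitK j).
case: (fintype.split j) => c.
  rewrite row_mxEl -derive_entry //; congr ('D_v _ x).
  by apply/funext => y; rewrite row_mxEl.
rewrite row_mxEr -derive_entry //; congr ('D_v _ x).
by apply/funext => y; rewrite row_mxEr.
Qed.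

Lemma diff_lincomb n (f : plane -> 'rV[R]_n) x v : differentiable f x ->
  'D_v f x = v 0 0 *: partial 0 f x + v 0 1 *: partial 1 f x.
Proof.
by move=> df; rewrite deriveE // {1}(plane_basis v) linearD !linearZ -!deriveE.
Qed.

Lemma derive_graph_map m (f : plane -> 'rV[R]_m) x v : differentiable f x ->
  'D_v (graph_map f) x = row_mx v (v 0 0 *: partial 0 f x + v 0 1 *: partial 1 f x).
Proof.
move=> df; rewrite derive_row_mx; [|exact: derivable_id|exact: diff_derivable].
by rewrite derive_id diff_lincomb.
Qed.

Lemma partial2_graph_map m (f : plane -> 'rV[R]_m) i j x : smooth f ->
  partial i (partial j (graph_map f)) x = row_mx 0 (partial i (partial j f) x).
Proof.
move=> sf.
have -> : partial j (graph_map f) = fun y => row_mx (delta_mx 0 j) (partial j f y).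
  by apply/funext => y; apply: partial_graph_map; exact: smooth_differentiable.
rewrite [LHS]derive_row_mx; first by rewrite derive_cst.
  exact: derivable_cst.
by apply/diff_derivable/smooth_differentiable/smooth_partial.
Qed.

End MinkowskiCalculus.

(** * From stationarity to a metric with constant conformal class *)

Section ConformallyFlat.
Variable R : realType.
Notation plane := 'rV[R]_2.

(* [a1, a2, a3] and [b1, b2, b3] stand for the products of the two tangent vectors
   with the second derivatives; the last two hypotheses on them express
   stationarity, which makes [E/w dx + F/w dy] and [F/w dx + G/w dy] closed for
   [w^2 = E G - F^2]. *)
Lemma metric_conformal_cst (E F G a1 a2 a3 b1 b2 b3 : plane -> R) :
  (forall x, 0 < E x) -> (forall x, 0 < E x * G x - F x ^+ 2) ->
  (forall x, grad_at E x (2 * a1 x) (2 * a2 x)) ->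
  (forall x, grad_at F x (b1 x + a2 x) (b2 x + a3 x)) ->
  (forall x, grad_at G x (2 * b2 x) (2 * b3 x)) ->
  (forall x, [/\ differentiable a1 x, differentiable a2 x & differentiable a3 x]) ->
  (forall x, [/\ differentiable b1 x, differentiable b2 x & differentiable b3 x]) ->
  (forall x, G x * a1 x - 2 * F x * a2 x + E x * a3 x = 0) ->
  (forall x, G x * b1 x - 2 * F x * b2 x + E x * b3 x = 0) ->
  exists r s t : R, [/\ r * t - s ^+ 2 = 1, 0 < t &
    forall x, exists w, [/\ E x = r * w, F x = s * w & G x = t * w]].
Proof.
move=> E0 D0 gE gF gG da db Sa Sb.
pose D x := E x * G x - F x * F x.
have Dpos x : 0 < D x by rewrite /D -expr2.
pose D1 x := 2 * (E x * b2 x + G x * a1 x - F x * (b1 x + a2 x)).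
pose D2 x := 2 * (E x * b3 x + G x * a2 x - F x * (b2 x + a3 x)).
have gD x : grad_at D x (D1 x) (D2 x).
  apply: (grad_eq (gradB (gradM (gE x) (gG x)) (gradM (gF x) (gF x)))); rewrite /D1 /D2; ring.
pose V x := (Num.sqrt (D x))^-1.
have V0 x : 0 < V x by rewrite invr_gt0 sqrtr_gt0.
have V2 x : V x * V x * D x = 1.
  rewrite /V -{3}(sqr_sqrtr (ltW (Dpos x))); field.
  by rewrite gt_eqF // sqrtr_gt0.
pose V1 x := - (2^-1 * (V x * V x * V x) * D1 x).
pose V2' x := - (2^-1 * (V x * V x * V x) * D2 x).
have gV x : grad_at V x (V1 x) (V2' x).
  have n0 : Num.sqrt (D x) != 0 by rewrite gt_eqF // sqrtr_gt0.
  apply: (grad_eq (gradV n0 (grad_comp (is_derive1_sqrt (Dpos x)) (gD x))));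
    by rewrite /V1 /V2' /V; field.
pose r x := E x * V x; pose s x := F x * V x; pose t x := G x * V x.
have gr x : grad_at r x _ _ := gradM (gE x) (gV x).
have gs x : grad_at s x _ _ := gradM (gF x) (gV x).
have gt x : grad_at t x _ _ := gradM (gG x) (gV x).
have det1 x : r x * t x - s x ^+ 2 = 1.
  by rewrite -(V2 x) /r /s /t /D; ring.
have r0 x : 0 < r x by rewrite mulr_gt0.
(* [key1] and [key2] are the closedness of the two forms with the powers of [V] cleared; each is a
   combination of the two stationarity equations. *)
have key1 x : 2 * (a2 x - b1 x) * D x = E x * D2 x - F x * D1 x.
  apply/eqP; rewrite -subr_eq0; apply/eqP.
  transitivity (2 * F x * (G x * a1 x - 2 * F x * a2 x + E x * a3 x) -
    2 * E x * (G x * b1 x - 2 * F x * b2 x + E x * b3 x)).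
    by rewrite /D /D1 /D2; ring.
  by rewrite Sa Sb !mulr0 subrr.
have key2 x : 2 * (b2 x - a3 x) * D x = G x * D1 x - F x * D2 x.
  apply/eqP; rewrite -subr_eq0; apply/eqP.
  transitivity (2 * F x * (G x * b1 x - 2 * F x * b2 x + E x * b3 x) -
    2 * G x * (G x * a1 x - 2 * F x * a2 x + E x * a3 x)).
    by rewrite /D /D1 /D2; ring.
  by rewrite Sa Sb !mulr0 subrr.
have rcl x : partial 1 r x = partial 0 s x.
  have [_ _ ->] := gr x; have [_ -> _] := gs x.
  apply/eqP; rewrite -subr_eq0; apply/eqP.
  transitivity (V x * (a2 x - b1 x) - 2^-1 * (V x * V x * V x) * (E x * D2 x - F x * D1 x)).
    by rewrite /V1 /V2'; ring.
  rewrite -key1; transitivity ((a2 x - b1 x) * V x * (1 - V x * V x * D x)); first by field.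
  by rewrite V2 subrr mulr0.
have tcl x : partial 0 t x = partial 1 s x.
  have [_ -> _] := gt x; have [_ _ ->] := gs x.
  apply/eqP; rewrite -subr_eq0; apply/eqP.
  transitivity (V x * (b2 x - a3 x) - 2^-1 * (V x * V x * V x) * (G x * D1 x - F x * D2 x)).
    by rewrite /V1 /V2'; ring.
  rewrite -key2; transitivity ((b2 x - a3 x) * V x * (1 - V x * V x * D x)); first by field.
  by rewrite V2 subrr mulr0.
have [s0E s1E] : partial 0 s = (fun x => F x * V1 x + V x * (b1 x + a2 x)) /\
    partial 1 s = (fun x => F x * V2' x + V x * (b2 x + a3 x)).
  by split; apply/funext => x; have [] := gs x.
have dE x := grad_differentiable (gE x); have dF x := grad_differentiable (gF x).
have dG x := grad_differentiable (gG x); have dV x := grad_differentiable (gV x).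
have dc (c : R) x : differentiable (fun _ : plane => c) x by exact: differentiable_cst.
have ds0 x : differentiable (partial 0 s) x.
  have [da1 da2 da3] := da x; have [db1 db2 db3] := db x; rewrite s0E.
  by repeat first [assumption | exact: dE | exact: dF | exact: dG | exact: dV | exact: dc |
    apply: differentiable_funB | apply: differentiableN | apply: differentiable_funM |
    apply: differentiable_funD].
have ds1 x : differentiable (partial 1 s) x.
  have [da1 da2 da3] := da x; have [db1 db2 db3] := db x; rewrite s1E.
  by repeat first [assumption | exact: dE | exact: dF | exact: dG | exact: dV | exact: dc |
    apply: differentiable_funB | apply: differentiableN | apply: differentiable_funM |
    apply: differentiable_funD].
have C := unimodular_hessian_cst det1 r0 (fun x => grad_differentiable (gr x))
  (fun x => grad_differentiable (gs x)) (fun x => grad_differentiable (gt x)) rcl tcl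
  (fun x => differentiable_continuous (ds0 x)) (fun x => differentiable_continuous (ds1 x)).
exists (r 0), (s 0), (t 0); split; first exact: det1.
  rewrite -(pmulr_rgt0 _ (r0 0)); have := det1 0; have := sqr_ge0 (s 0).
  (* The common factor [w] below is the area element: [V] is its inverse. *)
  move: (r 0 * t 0) (s 0 ^+ 2) => h k; lra.
move=> x; have [rE sE tE] := C x; exists (V x)^-1; rewrite -rE -sE -tE.
by split; rewrite mulfK // gt_eqF.
Qed.

End ConformallyFlat.

(** * Geometry of a stationary graph and the isothermal shear *)

Section StationaryGraph.
Variable R : realType.
Notation plane := 'rV[R]_2.
Notation e_ i := (delta_mx 0 i : plane).
Variables (m : nat) (f : plane -> 'rV[R]_m).
Hypothesis m_gt0 : (0 < m)%N.
Hypothesis f_smooth : smooth f.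
Hypothesis f_spacelike : spacelike (graph_map f).
Hypothesis f_stationary : stationary (graph_map f).

Let p := partial 0 f.
Let q := partial 1 f.
Let E x := 1 + minkowski (p x) (p x).
Let F x := minkowski (p x) (q x).
Let G x := 1 + minkowski (q x) (q x).

Let f_diff x : differentiable f x.
Proof. exact: smooth_differentiable. Qed.

Let sum2 (V : nmodType) (h : 'I_2 -> V) : \sum_(i < 2) h i = h 0 + h 1.
Proof.
by rewrite big_ord_recl big_ord1; congr (_ + h _); exact/val_inj.
Qed.

(** Second derivatives of a graph map have no component in the base plane, so that component of the
    mean curvature contains only the tangential corrections. Its vanishing makes their total
    coefficients [k0] and [k1] zero, and the fibre component then holds without any projection. *)
Let tangential_cancel (D e h g : R) (B : 'M[R]_2) (px qx v11 v12 v22 : 'rV[R]_m)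
    (a0 a1 b0 b1 c0 c1 : R) :
  D * B 0 0 = g -> D * B 0 1 = - h -> D * B 1 0 = - h -> D * B 1 1 = e ->
  B 0 0 *: row_mx (- (a0 *: e_ 0 + a1 *: e_ 1)) (v11 - (a0 *: px + a1 *: qx)) +
  B 0 1 *: row_mx (- (b0 *: e_ 0 + b1 *: e_ 1)) (v12 - (b0 *: px + b1 *: qx)) +
  (B 1 0 *: row_mx (- (b0 *: e_ 0 + b1 *: e_ 1)) (v12 - (b0 *: px + b1 *: qx)) +
   B 1 1 *: row_mx (- (c0 *: e_ 0 + c1 *: e_ 1)) (v22 - (c0 *: px + c1 *: qx))) = 0 ->
  g *: v11 - (2 * h) *: v12 + e *: v22 = 0.
Proof.
move=> B00 B01 B10 B11; rewrite !scale_row_mx !add_row_mx -row_mx0.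
move=> /eq_row_mx[/rowP H1 /rowP H2].
pose k0 := B 0 0 * a0 + B 0 1 * b0 + B 1 0 * b0 + B 1 1 * c0.
pose k1 := B 0 0 * a1 + B 0 1 * b1 + B 1 0 * b1 + B 1 1 * c1.
have k00 : k0 = 0.
  move: (H1 0); rewrite !mxE !eqxx /= => {}H1.
  by apply/eqP; rewrite -oppr_eq0 -[X in _ == X]H1 /k0; apply/eqP; ring.
have k10 : k1 = 0.
  move: (H1 1); rewrite !mxE !eqxx /= => {}H1.
  by apply/eqP; rewrite -oppr_eq0 -[X in _ == X]H1 /k1; apply/eqP; ring.
apply/rowP => j; move: (H2 j); rewrite !mxE.
move: (px 0 j) (qx 0 j) (v11 0 j) (v12 0 j) (v22 0 j) => pj qj f11 f12 f22 {}H2.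
have h2 : 2 * h = - (D * B 0 1) - D * B 1 0 by rewrite B01 B10; ring.
transitivity (D * (B 0 0 * f11 + B 0 1 * f12 + B 1 0 * f12 + B 1 1 * f22)).
  by rewrite -B00 -B11 h2; ring.
rewrite -[RHS](mulr0 D); congr (_ * _).
transitivity (0 + k0 * pj + k1 * qj); last by rewrite k00 k10; ring.
by rewrite -H2 /k0 /k1; ring.
Qed.

Lemma partialC x : partial 0 (partial 1 f) x = partial 1 (partial 0 f) x.
Proof.
apply/rowP => j.
have gE (S : plane -> 'rV[R]_m) y : smooth S ->
    grad_at (fun z => S z 0 j) y (partial 0 S y 0 j) (partial 1 S y 0 j).
  by move=> sS; exact/grad_entry/smooth_differentiable.
apply/esym; apply: (@young R (fun z => f z 0 j) (fun z => partial 0 f z 0 j)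
  (fun z => partial 1 f z 0 j) x _ _ _ _ 1 ltr01).
- by move=> y _; exact: gE.
- by apply: gE; exact: smooth_partial.
- by apply: gE; exact: smooth_partial.
Qed.

Lemma graph_metric x : [/\ metric (graph_map f) x 0 0 = E x,
  metric (graph_map f) x 0 1 = F x, metric (graph_map f) x 1 0 = F x &
  metric (graph_map f) x 1 1 = G x].
Proof.
have g i j := metric_graph_map m_gt0 i j (f_diff x).
split; rewrite g; last by rewrite eqxx.
- by rewrite eqxx.
- by rewrite add0r.
by rewrite add0r minkowskiC.
Qed.

Lemma metric_form_gt0 x a b : (a != 0) || (b != 0) ->
  0 < a ^+ 2 * E x + 2 * a * b * F x + b ^+ 2 * G x.
Proof.
move=> ab; have [g00 g01 g10 g11] := graph_metric x.
have v0 : pt a b != 0.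
  apply: contraTneq ab => v0; have := pt0 a b; have := pt1 a b.
  by rewrite v0 !mxE => <- <-; rewrite eqxx.
have := f_spacelike x v0.
move: (metric _ x) g00 g01 g10 g11 => g g00 g01 g10 g11; congr (0 < _).
by rewrite !mxE sum2 !mxE !sum2 g00 g01 g10 g11 pt0 pt1 !eqxx /=; ring.
Qed.

Lemma metric_E_gt0 x : 0 < E x.
Proof.
have := @metric_form_gt0 x 1 0; rewrite oner_eq0 => /(_ isT); congr (0 < _); ring.
Qed.

Lemma metric_det_gt0 x : 0 < E x * G x - F x ^+ 2.
Proof.
rewrite -(pmulr_rgt0 _ (metric_E_gt0 x)).
(* On the vector [(-F, E)] the metric takes the value [E (E G - F^2)]. *)
have := @metric_form_gt0 x (- F x) (E x); rewrite (gt_eqF (metric_E_gt0 x)) orbT => /(_ isT).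
congr (0 < _); ring.
Qed.

Lemma inverse_metric x (D := E x * G x - F x ^+ 2) (B := invmx (metric (graph_map f) x)) :
  [/\ D * B 0 0 = G x, D * B 0 1 = - F x, D * B 1 0 = - F x & D * B 1 1 = E x].
Proof.
have [g00 g01 g10 g11] := graph_metric x.
have D0 : D != 0 by rewrite gt_eqF // metric_det_gt0.
have gU : metric (graph_map f) x \in unitmx.
  rewrite -row_free_unit; apply/row_freeP.
  exists (D^-1 *: \matrix_(i, j) (if i == 0 then if j == 0 then G x else - F x
    else if j == 0 then - F x else E x)).
  move: (metric _ x) g00 g01 g10 g11 => g g00 g01 g10 g11.
  apply/matrixP => i j; rewrite !mxE sum2 !mxE.
  by case: (ord2P i) => ->; case: (ord2P j) => ->;
    rewrite !eqxx /= (g00, g10) (g01, g11) /D; field; exact: D0.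
have := mulmxV gU; rewrite -/B => /matrixP gB.
have := gB 0 0; have := gB 0 1; have := gB 1 0; have := gB 1 1.
move: (metric _ x) g00 g01 g10 g11 {gB gU} B => g g00 g01 g10 g11 B.
rewrite !mxE !sum2 g00 g01 g10 g11 !eqxx /= => b11 b10 b01 b00.
split.
- transitivity (G x * (E x * B 0 0 + F x * B 1 0) - F x * (F x * B 0 0 + G x * B 1 0)).
    by rewrite /D; ring.
  by rewrite b00 b10; ring.
- transitivity (G x * (E x * B 0 1 + F x * B 1 1) - F x * (F x * B 0 1 + G x * B 1 1)).
    by rewrite /D; ring.
  by rewrite b01 b11; ring.
- transitivity (E x * (F x * B 0 0 + G x * B 1 0) - F x * (E x * B 0 0 + F x * B 1 0)).
    by rewrite /D; ring.
  by rewrite b00 b10; ring.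
transitivity (E x * (F x * B 0 1 + G x * B 1 1) - F x * (E x * B 0 1 + F x * B 1 1)).
  by rewrite /D; ring.
by rewrite b01 b11; ring.
Qed.

(** The coefficients can stay implicit: [tangential_cancel] eliminates them. *)
Lemma normal_part_row_mx x (w : 'rV[R]_m) : exists c0 c1,
  normal_part (graph_map f) x (row_mx 0 w) =
  row_mx (- (c0 *: e_ 0 + c1 *: e_ 1)) (w - (c0 *: p x + c1 *: q x)).
Proof.
pose c l := \sum_k invmx (metric (graph_map f) x) k l *
  minkowski (row_mx 0 w) (partial k (graph_map f) x).
have -> : normal_part (graph_map f) x (row_mx 0 w) =
    row_mx 0 w - \sum_l c l *: partial l (graph_map f) x.
  rewrite /normal_part exchange_big; congr (_ - _).
  by apply: eq_bigr => l _; rewrite scaler_suml.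
exists (c 0), (c 1); move: c => c.
rewrite sum2 (partial_graph_map 0 (f_diff x)) (partial_graph_map 1 (f_diff x)).
by rewrite !scale_row_mx add_row_mx opp_row_mx add_row_mx add0r.
Qed.

(** The nonparametric form of the vanishing of the mean curvature, multiplied by the determinant of
    the metric. *)
Lemma stationary_eq x :
  G x *: partial 0 p x - (2 * F x) *: partial 1 p x + E x *: partial 1 q x = 0.
Proof.
have [B00 B01 B10 B11] := inverse_metric x; have D0 := metric_det_gt0 x.
move: (f_stationary x); rewrite /mean_curvature.
move: (invmx _) B00 B01 B10 B11 => B B00 B01 B10 B11.
move/eqP; rewrite scaler_eq0 => /orP[|/eqP]; first by rewrite invr_eq0 pnatr_eq0.
have sum22 (N : 'I_2 -> 'I_2 -> 'rV[R]_(2 + m)) n00 n01 n10 n11 :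
    N 0 0 = n00 -> N 0 1 = n01 -> N 1 0 = n10 -> N 1 1 = n11 ->
    \sum_i \sum_j B i j *: N i j =
    B 0 0 *: n00 + B 0 1 *: n01 + (B 1 0 *: n10 + B 1 1 *: n11).
  by move=> <- <- <- <-; rewrite sum2 2!sum2.
have [a0 [a1 Ha]] := normal_part_row_mx x (partial 0 p x).
have [b0 [b1 Hb]] := normal_part_row_mx x (partial 1 p x).
have [c0 [c1 Hc]] := normal_part_row_mx x (partial 1 q x).
have H i j w n : partial i (partial j f) x = w ->
    normal_part (graph_map f) x (row_mx 0 w) = n ->
    normal_part (graph_map f) x (partial i (partial j (graph_map f)) x) = n.
  by move=> <- <-; rewrite (partial2_graph_map i j x f_smooth).
rewrite (sum22
  (fun i j => normal_part (graph_map f) x (partial i (partial j (graph_map f)) x))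
  _ _ _ _ (H 0 0 _ _ erefl Ha) (H 0 1 _ _ (partialC x) Hb)
  (H 1 0 _ _ erefl Hb) (H 1 1 _ _ erefl Hc)).
exact: (tangential_cancel B00 B01 B10 B11).
Qed.

Let dmink (P Q : plane -> 'rV[R]_m) x : smooth P -> smooth Q ->
  differentiable (fun y => minkowski (P y) (Q y)) x.
Proof. by move=> sP sQ; apply: smooth_differentiable; exact: smooth_minkowski. Qed.

Lemma stationary_graph_metric_cst :
  exists r s t : R, [/\ r * t - s ^+ 2 = 1, 0 < t &
    forall x, exists w, [/\ E x = r * w, F x = s * w & G x = t * w]].
Proof.
have sp : smooth p by exact: smooth_partial.
have sq : smooth q by exact: smooth_partial.
have sp0 : smooth (partial 0 p) by exact: smooth_partial.
have sp1 : smooth (partial 1 p) by exact: smooth_partial.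
have sq1 : smooth (partial 1 q) by exact: smooth_partial.
have gm (P Q : plane -> 'rV[R]_m) x (sP : smooth P) (sQ : smooth Q) :
    grad_at (fun y => minkowski (P y) (Q y)) x _ _ :=
  grad_minkowski (smooth_differentiable x sP) (smooth_differentiable x sQ).
have qp x : partial 0 q x = partial 1 p x by exact: partialC.
have alg (e h g : R) (u v z w : 'rV[R]_m) : g *: u - (2 * h) *: v + e *: z = 0 ->
    g * minkowski w u - 2 * h * minkowski w v + e * minkowski w z = 0.
  move=> uvz; rewrite -[RHS](minkowski0l w) -uvz -(scaleNr _ v) !minkowskiDl !minkowskiZl.
  by rewrite (minkowskiC w u) (minkowskiC w v) (minkowskiC w z); ring.
have dbl (u v : 'rV[R]_m) : 0 + (minkowski u v + minkowski v u) = 2 * minkowski v u.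
  by rewrite (minkowskiC u v); ring.
(* Pairing the vector equation with [w = p x] and [w = q x] gives the two scalar equations
   required. *)
have stat w x := alg _ _ _ _ _ _ w (stationary_eq x).
apply: (@metric_conformal_cst R E F G
  (fun x => minkowski (p x) (partial 0 p x)) (fun x => minkowski (p x) (partial 1 p x))
  (fun x => minkowski (p x) (partial 1 q x)) (fun x => minkowski (q x) (partial 0 p x))
  (fun x => minkowski (q x) (partial 1 p x)) (fun x => minkowski (q x) (partial 1 q x))).
- exact: metric_E_gt0.
- exact: metric_det_gt0.
- move=> x; apply: (grad_eq (gradD (grad_cst 1 x) (gm p p x sp sp))); exact: dbl.
- move=> x; apply: (grad_eq (gm p q x sp sq)).
    exact: congr2 (minkowskiC _ _) (congr1 (minkowski (p x)) (qp x)).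
  exact: congr2 (minkowskiC _ _) erefl.
- move=> x; apply: (grad_eq (gradD (grad_cst 1 x) (gm q q x sq sq))); last exact: dbl.
  exact: etrans (dbl _ _) (congr1 (fun v => 2 * minkowski (q x) v) (qp x)).
- by move=> x; split; exact: dmink.
- by move=> x; split; exact: dmink.
- by move=> x; exact: stat.
by move=> x; exact: stat.
Qed.

Lemma metric_comp_shear a b u (x := shear a b u) : let g := metric (graph_map f \o shear a b) u in
  [/\ g 0 0 = E x + 2 * a * F x + a ^+ 2 * G x, g 0 1 = b * (F x + a * G x),
      g 1 0 = b * (F x + a * G x) & g 1 1 = b ^+ 2 * G x].
Proof.
move=> g.
have s00 : shear a b (e_ 0) 0 0 = 1 by rewrite !mxE.
have s01 : shear a b (e_ 0) 0 1 = a by rewrite !mxE /=; ring.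
have s10 : shear a b (e_ 1) 0 0 = 0 by rewrite !mxE.
have s11 : shear a b (e_ 1) 0 1 = b by rewrite !mxE /=; ring.
have entries (h : 'I_2 -> 'I_2 -> R) (pp pq qq : R) : (forall i j, h i j =
    (shear a b (e_ i) 0 0 * shear a b (e_ j) 0 0 +
      shear a b (e_ i) 0 1 * shear a b (e_ j) 0 1) +
    (shear a b (e_ i) 0 0 * shear a b (e_ j) 0 0 * pp +
     (shear a b (e_ i) 0 0 * shear a b (e_ j) 0 1 +
      shear a b (e_ i) 0 1 * shear a b (e_ j) 0 0) * pq +
     shear a b (e_ i) 0 1 * shear a b (e_ j) 0 1 * qq)) ->
  [/\ h 0 0 = 1 + pp + 2 * a * pq + a ^+ 2 * (1 + qq), h 0 1 = b * (pq + a * (1 + qq)),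
      h 1 0 = b * (pq + a * (1 + qq)) & h 1 1 = b ^+ 2 * (1 + qq)].
  by move=> hE; split; rewrite hE ?s00 ?s01 ?s10 ?s11; ring.
have gE i j : g i j = (shear a b (e_ i) 0 0 * shear a b (e_ j) 0 0 +
      shear a b (e_ i) 0 1 * shear a b (e_ j) 0 1) +
    (shear a b (e_ i) 0 0 * shear a b (e_ j) 0 0 * minkowski (p x) (p x) +
     (shear a b (e_ i) 0 0 * shear a b (e_ j) 0 1 +
      shear a b (e_ i) 0 1 * shear a b (e_ j) 0 0) * minkowski (p x) (q x) +
     shear a b (e_ i) 0 1 * shear a b (e_ j) 0 1 * minkowski (q x) (q x)).
  have D k : partial k (graph_map f \o shear a b) u = row_mx (shear a b (e_ k))
      (shear a b (e_ k) 0 0 *: p x + shear a b (e_ k) 0 1 *: q x).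
    exact: etrans (derive_shear _ _ _ _ _) (derive_graph_map _ (f_diff x)).
  have -> : g i j = minkowski (partial i (graph_map f \o shear a b) u)
    (partial j (graph_map f \o shear a b) u) by rewrite mxE.
  by rewrite (D i) (D j) (minkowski_row_mx m_gt0) sum2 minkowski_lincomb.
exact: entries gE.
Qed.

Lemma stationary_graph_isothermal :
  exists a b : R, 0 < b /\ global_isothermal (graph_map f) (shear a b).
Proof.
have [r [s [t [det1 t0 H]]]] := stationary_graph_metric_cst.
have tn0 : t != 0 by rewrite gt_eqF.
(* Orthogonality of the new coordinate vectors means [s + a t = 0]. Then [r + 2 a s + a^2 t = (r t -
   s^2) / t = 1 / t], and equating this with [b^2 t] gives [b = 1 / t]. *)
exists (- s / t), t^-1; split; first by rewrite invr_gt0.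
set a := - s / t; set b := t^-1.
have b0 : b != 0 by rewrite invr_eq0.
split; first exact: smooth_shear.
  exists (shear (- (a / b)) b^-1); split; first exact: smooth_shear.
    exact: shearK.
  exact: shearKV.
have G_gt0 x : 0 < G x.
  have := @metric_form_gt0 x 0 1; rewrite oner_eq0 orbT => /(_ isT); congr (0 < _); ring.
exists (fun u => b ^+ 2 * G (shear a b u)); split.
- move=> k; apply: class_CM; first exact: class_C_cst.
  apply: (@class_C_comp_shear R k G); apply: class_CD; first exact: class_C_cst.
  by apply: smooth_minkowski; exact: smooth_partial.
- by move=> u; rewrite mulr_gt0 // exprn_gt0 // invr_gt0.
move=> u; have [g00 g01 g10 g11] := metric_comp_shear a b u.
have [w [Ew Fw Gw]] := H (shear a b u); rewrite Ew Fw Gw in g00 g01 g10 g11.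
move: (metric _ u) g00 g01 g10 g11 => g g00 g01 g10 g11.
have off0 : b * (s * w + a * (t * w)) = 0 by rewrite /a /b; field.
have diagE : r * w + 2 * a * (s * w) + a ^+ 2 * (t * w) = b ^+ 2 * (t * w).
  transitivity ((r * t - s ^+ 2) * (w / t)); first by rewrite /a /b; field.
  by rewrite det1 /b; field.
apply/matrixP => i j; rewrite mxE Gw.
case: (ord2P i) => ->; case: (ord2P j) => ->; rewrite ?eqxx /=.
- by rewrite g00 diagE.
- by rewrite g01 off0.
- by rewrite g10 off0.
by rewrite g11.
Qed.

End StationaryGraph.

Theorem theorem3p1 (R : realType) (m : nat) (m_ge1 : (1 <= m)%N)
    (f : 'rV[R]_2 -> 'rV[R]_m) (f_smooth : smooth f)
    (M_spacelike : spacelike (graph_map f))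
    (M_stationary : stationary (graph_map f)) :
  exists a b : R, 0 < b /\ global_isothermal (graph_map f) (shear a b).

Proof. exact: stationary_graph_isothermal. Qed.
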